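(* Fix $k\in\{1,2,\dots\}\cup\{\infty\}$. Let $\mathcal{S}$ range over $C^k$-structures on the line with two origins $\mathbb{L}$. Then: (1) the assignment $[\mathcal{S}]\mapsto D^k(\mathbb{R},0)\,\gamma_{\mathcal{A}}\,D^k(\mathbb{R},0)\cup D^k(\mathbb{R},0)\,\gamma_{\mathcal{A}}^{-1}\,D^k(\mathbb{R},0)$, where $\mathcal{A}\in\mathcal{S}$ is any minimal atlas and $\gamma_{\mathcal{A}}$ is the $0$-extension of its transition map, is a well-defined bijection from the set of $C^k$-structures on $\mathbb{L}$ modulo $C^k$-diffeomorphism onto the set $D^k(\mathbb{R},0)\backslash\!\backslash^{\pm} H^k(\mathbb{R},0)$ of $(D^k(\mathbb{R},0),\pm)$-double cosets in $H^k(\mathbb{R},0)$; (2) the assignment $[\mathcal{S}]^{\mathrm{fix}}\mapsto D^k(\mathbb{R},0)\,\gamma_{\mathcal{A}}\,D^k(\mathbb{R},0)$, with $\mathcal{A}\in\mathcal{S}$ any minimal atlas, is a well-defined bijection from the set of $C^k$-structures on $\mathbb{L}$ modulo $C^k$-diffeomorphisms fixing both $0$ and $0'$ onto the set $D^k(\mathbb{R},0)\backslash H^k(\mathbb{R},0)/D^k(\mathbb{R},0)$ of $D^k(\mathbb{R},0)$-double cosets in $H^k(\mathbb{R},0)$.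
   Context: The line with two origins $\mathbb{L}$ is the set $\mathbb{R}\sqcup\{0'\}$ whose open sets are the open subsets of $\mathbb{R}$ together with all sets $(W\setminus\{0\})\cup\{0'\}$ with $W\subset\mathbb{R}$ open and $0\in W$. Put $U=\mathbb{L}\setminus\{0'\}=\mathbb{R}$ and $V=\mathbb{L}\setminus\{0\}=(\mathbb{R}\setminus\{0\})\cup\{0'\}$. A chart is a homeomorphism of an open subset of $\mathbb{L}$ onto an open subset of $\mathbb{R}$; two charts are $C^k$-compatible if their domains are disjoint or the transition map between them is a $C^k$-diffeomorphism; a $C^k$-atlas is a family of pairwise compatible charts covering $\mathbb{L}$; a $C^k$-structure is an equivalence class of $C^k$-atlases, two atlases being equivalent if their union is a $C^k$-atlas. A $C^k$-diffeomorphism between structures is a homeomorphism which, together with its inverse, is $C^k$ in local charts of the structures. Every homeomorphism of $\mathbb{L}$ either fixes both $0,0'$ or exchanges them. $H^k(\mathbb{R},0)$ is the group of homeomorphisms $h$ of $\mathbb{R}$ with $h(0)=0$ whose restriction to $\mathbb{R}\setminus\{0\}$ is a $C^k$-diffeomorphism of $\mathbb{R}\setminus\{0\}$; $D^k(\mathbb{R},0)\subset H^k(\mathbb{R},0)$ is the subgroup of $C^k$-diffeomorphisms of $\mathbb{R}$ fixing $0$. The $D^k(\mathbb{R},0)$-double coset of $h$ is $\{ahb: a,b\in D^k(\mathbb{R},0)\}$, and the $(D^k(\mathbb{R},0),\pm)$-double coset of $h$ is the union of the double cosets of $h$ and $h^{-1}$. A minimal atlas is a $C^k$-atlas $\{(U,\varphi),(V,\psi)\}$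 with $\varphi\colon U\to\mathbb{R}$, $\psi\colon V\to\mathbb{R}$ homeomorphisms onto $\mathbb{R}$ and $\varphi(0)=\psi(0')=0$; its transition map $\psi\circ\varphi^{-1}\colon\mathbb{R}\setminus\{0\}\to\mathbb{R}\setminus\{0\}$ has a unique extension $\gamma_{\mathcal{A}}\in H^k(\mathbb{R},0)$ with $\gamma_{\mathcal{A}}(0)=0$, called its $0$-extension. Every $C^k$-structure on $\mathbb{L}$ contains minimal atlases. *)

(* Defs.v *)
From Stdlib Require Import Reals.
From Coquelicot Require Import Coquelicot.
Open Scope R_scope.

Inductive reg := Fin (n : nat) | Inf.
Definition le_reg (n : nat) (k : reg) : Prop :=
  match k with Fin m => (n <= m)%nat | Inf => True end.

Definition Ck_on (k : reg) (U : R -> Prop) (f : R -> R) : Prop :=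
  forall n : nat, le_reg n k ->
    forall x, U x -> ex_derive_n f n x /\ continuous (Derive_n f n) x.

(** The line with two origins: pt 0 is the origin 0, origin' is 0'. *)
Inductive L := pt (x : R) | origin'.

(** Second copy of R inside L: x |-> x for x <> 0, 0 |-> 0'. *)
Definition sw (x : R) : L :=
  match Req_EM_T x 0 with left _ => origin' | right _ => pt x end.

(** Topology of L (generated by the sets described in the paper):
    S is open iff its traces on both copies of R are open. *)
Definition openL (S : L -> Prop) : Prop :=
  open (fun x => S (pt x)) /\ open (fun x => S (sw x)).

Definition Uset : L -> Prop := fun p => p <> origin'.
Definition Vset : L -> Prop := fun p => p <> pt 0.

Definition imageR (D : L -> Prop) (phi : L -> R) : R -> Prop :=
  fun y => exists p, D p /\ phi p = y.

Definition is_chart (D : L -> Prop) (phi : L -> R) : Prop :=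
  openL D /\ open (imageR D phi) /\
  (forall p q, D p -> D q -> phi p = phi q -> p = q) /\
  (forall O : R -> Prop, open O -> openL (fun p => D p /\ O (phi p))) /\
  (forall S : L -> Prop, openL S -> (forall p, S p -> D p) ->
       open (imageR S phi)).

Definition Ck_trans (k : reg) (D1 : L -> Prop) (phi1 : L -> R)
    (D2 : L -> Prop) (phi2 : L -> R) : Prop :=
  exists F : R -> R,
    Ck_on k (imageR (fun p => D1 p /\ D2 p) phi1) F /\
    forall p, D1 p -> D2 p -> F (phi1 p) = phi2 p.

Definition compat (k : reg) (D1 : L -> Prop) (phi1 : L -> R)
    (D2 : L -> Prop) (phi2 : L -> R) : Prop :=
  (forall p, ~ (D1 p /\ D2 p)) \/
  (Ck_trans k D1 phi1 D2 phi2 /\ Ck_trans k D2 phi2 D1 phi1).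

Definition atlasT := (L -> Prop) -> (L -> R) -> Prop.

Definition atlas (k : reg) (A : atlasT) : Prop :=
  (forall D phi, A D phi -> is_chart D phi) /\
  (forall D1 phi1 D2 phi2, A D1 phi1 -> A D2 phi2 -> compat k D1 phi1 D2 phi2) /\
  (forall p, exists D phi, A D phi /\ D p).

(** Two atlases define the same C^k-structure iff their union is an atlas. *)
Definition equiv_atlas (k : reg) (A B : atlasT) : Prop :=
  atlas k (fun D phi => A D phi \/ B D phi).

(** Charts of the structure determined by A (its maximal atlas). *)
Definition inS (k : reg) (A : atlasT) (D : L -> Prop) (phi : L -> R) : Prop :=
  is_chart D phi /\ forall D' phi', A D' phi' -> compat k D phi D' phi'.

Definition contL (f : L -> L) : Prop :=
  forall S, openL S -> openL (fun p => S (f p)).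

Definition CkL (k : reg) (A B : atlasT) (f : L -> L) : Prop :=
  forall D1 phi1 D2 phi2, inS k A D1 phi1 -> inS k B D2 phi2 ->
    exists F : R -> R,
      Ck_on k (imageR (fun p => D1 p /\ D2 (f p)) phi1) F /\
      forall p, D1 p -> D2 (f p) -> F (phi1 p) = phi2 (f p).

Definition diffeo (k : reg) (A B : atlasT) (f : L -> L) : Prop :=
  exists g : L -> L, (forall p, g (f p) = p /\ f (g p) = p) /\
    contL f /\ contL g /\ CkL k A B f /\ CkL k B A g.

Definition fixes_origins (f : L -> L) : Prop :=
  f (pt 0) = pt 0 /\ f origin' = origin'.

Definition Mat (phi psi : L -> R) : atlasT :=
  fun D chi => (D = Uset /\ chi = phi) \/ (D = Vset /\ chi = psi).

Definition minimal_atlas (k : reg) (phi psi : L -> R) : Prop :=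
  atlas k (Mat phi psi) /\
  (forall y, exists p, Uset p /\ phi p = y) /\
  (forall y, exists p, Vset p /\ psi p = y) /\
  phi (pt 0) = 0 /\ psi origin' = 0.

Definition zext (phi psi : L -> R) (gamma : R -> R) : Prop :=
  gamma 0 = 0 /\ forall x, x <> 0 -> gamma (phi (pt x)) = psi (pt x).

Definition inverses (h h' : R -> R) : Prop :=
  forall x, h' (h x) = x /\ h (h' x) = x.

Definition Hk (k : reg) (h : R -> R) : Prop :=
  exists h', inverses h h' /\ (forall x, continuous h x) /\
    (forall x, continuous h' x) /\ h 0 = 0 /\
    Ck_on k (fun x => x <> 0) h /\ Ck_on k (fun x => x <> 0) h'.

Definition Dk (k : reg) (a : R -> R) : Prop :=
  exists a', inverses a a' /\ a 0 = 0 /\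
    Ck_on k (fun _ => True) a /\ Ck_on k (fun _ => True) a'.

Definition dcoset (k : reg) (h : R -> R) : (R -> R) -> Prop :=
  fun g => exists a b, Dk k a /\ Dk k b /\ forall x, g x = a (h (b x)).

Definition pmcoset (k : reg) (h : R -> R) : (R -> R) -> Prop :=
  fun g => dcoset k h g \/ exists h', inverses h h' /\ dcoset k h' g.

(* Main.v *)
Require Import Defs.
From Stdlib Require Import ZArith Reals Ranalysis5 Lra Lia.
From Stdlib Require Import Classical ClassicalEpsilon FunctionalExtensionality.
From Coquelicot Require Import Coquelicot.
Open Scope R_scope.

(** The analytic core is that a C^k-structure on R has a global chart. Around each point,
    composing a chart with a smooth step function gives a nondecreasing function on R which is
    C^k in the structure, locally constant outside a small interval, and regular near the
    point. Derivatives of nondecreasing functions in a common chart have the same sign, so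
    sums of such functions stay regular wherever one summand is; by compactness finitely many
    of them cover each [n, n + 1], and the resulting locally finite sum is an unbounded
    increasing function with nonvanishing derivative in charts, i.e. a global chart.

    Applied to the two copies U and V of R in L this yields minimal atlases. A diffeomorphism
    f that fixes both origins acts in the charts of minimal atlases by elements
    b of D^k on U and a of D^k on V, and gamma' b = a gamma; conversely such an identity lets
    b and a be glued to a diffeomorphism of L. The two origins are the only pair of points that
    cannot be separated, so every other diffeomorphism exchanges them, which amounts to reading
    one of the atlases from the other origin and replaces gamma by its inverse. *)

(** * Calculus of C^k functions *)

(** The obstacle is orientation. Charts may preserve or reverse the order of R, so summands with
    nonzero derivatives could cancel if they were only defined chart by chart. Monotonicity for the
    order of R itself makes all signs agree without choosing orientations. This is why the summands
    are steps rather than bumps of compact support, and why the summands on the negative side are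
    shifted down by constants.

    Charts are not inverted to write coordinate expressions: g is C^k in the chart f near x when g =
    F ∘ f near x for some C^k germ F ([RCk] on R, [LCk] on L). Compatibility and maps then compose
    by transitivity, and [LCk_glue] recovers the functions defined on whole images. The condition
    [k <> Fin 0] supplies the continuous derivative that the inverse function theorem needs.

    On L, the correspondence between diffeomorphisms and double cosets is proved for two independent
    choices of a first origin, one in each structure. Preserving and exchanging the origins are then
    two instances of one statement. *)

Fixpoint Cn (n : nat) (U : R -> Prop) (f : R -> R) : Prop :=
  match n with
  | O => forall x, U x -> continuous f x
  | S n => exists f' : R -> R, (forall x, U x -> is_derive f x (f' x)) /\ Cn n U f'
  end.

Lemma is_derive_continuous (f : R -> R) (x l : R) : is_derive f x l -> continuous f x.
Proof.
  intros H. apply (ex_derive_continuous f). exists l. exact H.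
Qed.

Lemma Cn_continuous n U f x : Cn n U f -> U x -> continuous f x.
Proof.
  destruct n as [|n].
  - intros H Hx. exact (H x Hx).
  - intros [f' [H _]] Hx. exact (is_derive_continuous f x _ (H x Hx)).
Qed.

Lemma Cn_pred n U f : Cn (S n) U f -> Cn n U f.
Proof.
  revert f; induction n as [|n IH]; intros f.
  - intros H x Hx. exact (Cn_continuous 1 U f x H Hx).
  - intros [f' [H H']]. exists f'. split; [exact H|]. exact (IH f' H').
Qed.

Lemma Cn_sub n (U W : R -> Prop) f : (forall x, W x -> U x) -> Cn n U f -> Cn n W f.
Proof.
  intros HW; revert f; induction n as [|n IH]; intros f.
  - intros H x Hx. apply H, HW, Hx.
  - intros [f' [H H']]. exists f'. split; [intros x Hx; apply H, HW, Hx|].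
    exact (IH f' H').
Qed.

Lemma Cn_ext n U f g : open U -> (forall x, U x -> f x = g x) -> Cn n U f -> Cn n U g.
Proof.
  intros HU E H.
  assert (L : forall x, U x -> locally x (fun y => f y = g y)).
  { intros x Hx. apply (filter_imp U); [exact E|exact (HU x Hx)]. }
  destruct n as [|n].
  - intros x Hx. apply (continuous_ext_loc g f); [exact (L x Hx)|exact (H x Hx)].
  - destruct H as [f' [H H']]. exists f'. split; [|exact H'].
    intros x Hx. apply (is_derive_ext_loc f g); [exact (L x Hx)|exact (H x Hx)].
Qed.

Lemma Cn_const n U c : Cn n U (fun _ => c).
Proof.
  revert c; induction n as [|n IH]; intros c.
  - intros x _. apply continuous_const.
  - exists (fun _ => 0). split; [|apply IH].
    intros x _. apply (is_derive_const (K := R_AbsRing) (V := R_NormedModule) c x).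
Qed.

Lemma Cn_id n U : Cn n U (fun x => x).
Proof.
  destruct n as [|n].
  - intros x _. apply continuous_id.
  - exists (fun _ => 1). split; [|apply Cn_const].
    intros x _. apply (is_derive_id (K := R_AbsRing) x).
Qed.

Lemma Cn_plus n U f g : Cn n U f -> Cn n U g -> Cn n U (fun x => f x + g x).
Proof.
  revert f g; induction n as [|n IH]; intros f g.
  - intros Hf Hg x Hx. apply (continuous_plus f g); auto.
  - intros [f' [Hf Hf']] [g' [Hg Hg']]. exists (fun x => f' x + g' x).
    split; [|auto]. intros x Hx. apply (is_derive_plus f g); auto.
Qed.

Lemma Cn_mult n U f g : Cn n U f -> Cn n U g -> Cn n U (fun x => f x * g x).
Proof.
  revert f g; induction n as [|n IH]; intros f g Hf Hg.
  - intros x Hx. apply (continuous_mult f g); auto.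
  - pose proof (Cn_pred _ _ _ Hf) as Cf. pose proof (Cn_pred _ _ _ Hg) as Cg.
    destruct Hf as [f' [Hf Hf']], Hg as [g' [Hg Hg']].
    exists (fun x => f' x * g x + f x * g' x). split.
    + intros x Hx. apply (is_derive_mult f g x (f' x) (g' x)); auto.
      intros a b. apply Rmult_comm.
    + apply Cn_plus; auto.
Qed.

Lemma Cn_comp n (U W : R -> Prop) f g :
  (forall x, U x -> W (g x)) -> Cn n W f -> Cn n U g -> Cn n U (fun x => f (g x)).
Proof.
  intros HW; revert f g HW; induction n as [|n IH]; intros f g HW Hf Hg.
  - intros x Hx. apply (continuous_comp g f); auto.
  - pose proof (Cn_pred _ _ _ Hg) as Cg.
    destruct Hf as [f' [Hf Hf']], Hg as [g' [Hg Hg']].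
    exists (fun x => g' x * f' (g x)). split.
    + intros x Hx. apply (is_derive_comp f g x (f' (g x)) (g' x)); auto.
    + apply Cn_mult; auto.
Qed.

Lemma Cn_inv n U f : (forall x, U x -> f x <> 0) -> Cn n U f -> Cn n U (fun x => / f x).
Proof.
  intros Hn; revert f Hn; induction n as [|n IH]; intros f Hn Hf.
  - intros x Hx. apply continuous_comp; [auto|].
    apply (is_derive_continuous Rinv (f x) (- 1 / (f x) ^ 2)).
    apply (is_derive_inv (fun y => y)); [|auto].
    apply (is_derive_id (K := R_AbsRing) (f x)).
  - pose proof (Cn_pred _ _ _ Hf) as Cf. destruct Hf as [f' [Hf Hf']].
    (* The square is written as a product so that the induction hypothesis for [/ f] applies to each
       factor. *)
    exists (fun x => (-1 * f' x) * (/ f x * / f x)). split.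
    + intros x Hx.
      replace ((-1 * f' x) * (/ f x * / f x)) with (- f' x / f x ^ 2)
        by (field; auto).
      apply is_derive_inv; auto.
    + repeat apply Cn_mult; auto. apply Cn_const.
Qed.

Lemma Cn_Derive_n n m U f : Ck_on (Fin (n + m)) U f -> Cn n U (Derive_n f m).
Proof.
  revert m; induction n as [|n IH]; intros m H.
  - intros x Hx. apply (H m); [simpl; lia|exact Hx].
  - exists (Derive_n f (S m)). split.
    + intros x Hx. destruct (H (S m)) with (x := x) as [D _]; [simpl; lia|exact Hx|].
      apply Derive_correct. exact D.
    + apply IH. replace (n + S m)%nat with (S n + m)%nat by lia. exact H.
Qed.

(** The witness f' agrees with the derivative of f only on U; since U is open, the agreement holds
    near each point and survives further differentiation. *)
Lemma Ck_on_of_Cn n U f : open U -> Cn n U f -> Ck_on (Fin n) U f.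
Proof.
  intros HU; revert f; induction n as [|n IH]; intros f Hf m Hm x Hx; simpl in Hm.
  - replace m with O by lia. split; [exact I|exact (Hf x Hx)].
  - destruct m as [|m].
    { split; [exact I|]. exact (Cn_continuous (S n) U f x Hf Hx). }
    destruct Hf as [f' [Hf Hf']].
    assert (E : forall j y, U y -> Derive_n f (S j) y = Derive_n f' j y).
    { intros j y Hy. rewrite <- (Nat.add_1_r j), <- Derive_n_comp.
      apply Derive_n_ext_loc. apply (filter_imp U); [|exact (HU y Hy)].
      intros z Hz. apply is_derive_unique. exact (Hf z Hz). }
    assert (E' : forall j, locally x (fun y => Derive_n f' j y = Derive_n f (S j) y)).
    { intros j. apply (filter_imp U); [|exact (HU x Hx)].
      intros z Hz. symmetry. apply E, Hz. }
    destruct (IH f' Hf' m ltac:(simpl; lia) x Hx) as [D C]. split.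
    + destruct m as [|m].
      * exists (f' x). exact (Hf x Hx).
      * apply (ex_derive_ext_loc (Derive_n f' m)); [apply E'|exact D].
    + apply (continuous_ext_loc _ (Derive_n f' m)); [apply E'|exact C].
Qed.

(** * Pointwise C^k regularity and local inverses *)

Lemma le_reg_trans m n k : (m <= n)%nat -> le_reg n k -> le_reg m k.
Proof. destruct k; simpl; lia. Qed.

Lemma Ck_on_Cn k U f : open U -> (Ck_on k U f <-> forall n, le_reg n k -> Cn n U f).
Proof.
  intros HU. split.
  - intros H n Hn. apply (Cn_Derive_n n 0 U f). intros m Hm x Hx.
    apply H; [|exact Hx]. apply (le_reg_trans m n); [simpl in Hm; lia|exact Hn].
  - intros H n Hn. apply (Ck_on_of_Cn n U f HU (H n Hn) n). simpl; lia.
Qed.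

(** One neighbourhood has to serve all orders n at once, so for [Inf] this is smoothness near x and
    not a separate neighbourhood for each order. *)
Definition Ckat (k : reg) (f : R -> R) (x : R) : Prop :=
  exists U : R -> Prop, open U /\ U x /\ forall n, le_reg n k -> Cn n U f.

Lemma open_interior (P : R -> Prop) : open (fun x => locally x P).
Proof. intros x Hx. apply locally_locally. exact Hx. Qed.

Lemma locally_open_ex (x : R) (P : R -> Prop) :
  locally x P -> exists U : R -> Prop, open U /\ U x /\ forall y, U y -> P y.
Proof.
  intros H. exists (fun y => locally y P). split; [apply open_interior|].
  split; [exact H|]. intros y. apply locally_singleton.
Qed.

Lemma Ck_on_Ckat k U f : open U -> (Ck_on k U f <-> forall x, U x -> Ckat k f x).
Proof.
  intros HU. split.
  - intros H x Hx. exists U. split; [exact HU|]. split; [exact Hx|].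
    apply Ck_on_Cn; assumption.
  - intros H n Hn x Hx. destruct (H x Hx) as [W [HW [Wx HC]]].
    apply (Ck_on_Cn k W f HW); auto.
Qed.

Lemma Ckat_ext k f g x : locally x (fun y => f y = g y) -> Ckat k f x -> Ckat k g x.
Proof.
  intros E [U [HU [Ux H]]].
  destruct (locally_open_ex x _ E) as [W [HW [Wx EW]]].
  exists (fun y => U y /\ W y). split; [apply open_and; assumption|].
  split; [auto|]. intros n Hn. apply (Cn_ext n _ f); [apply open_and; assumption| |].
  - intros y [_ Hy]. auto.
  - apply (Cn_sub n U); [tauto|auto].
Qed.

Lemma Ckat_const k c x : Ckat k (fun _ => c) x.
Proof.
  exists (fun _ => True). split; [apply open_true|]. split; [exact I|].
  intros; apply Cn_const.
Qed.

Lemma Ckat_id k x : Ckat k (fun y => y) x.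
Proof.
  exists (fun _ => True). split; [apply open_true|]. split; [exact I|].
  intros; apply Cn_id.
Qed.

Lemma Ckat_plus k f g x : Ckat k f x -> Ckat k g x -> Ckat k (fun y => f y + g y) x.
Proof.
  intros [U [HU [Ux H]]] [W [HW [Wx H']]].
  exists (fun y => U y /\ W y). split; [apply open_and; assumption|].
  split; [auto|]. intros n Hn.
  apply Cn_plus; [apply (Cn_sub n U)|apply (Cn_sub n W)]; tauto || auto.
Qed.

Lemma Ckat_mult k f g x : Ckat k f x -> Ckat k g x -> Ckat k (fun y => f y * g y) x.
Proof.
  intros [U [HU [Ux H]]] [W [HW [Wx H']]].
  exists (fun y => U y /\ W y). split; [apply open_and; assumption|].
  split; [auto|]. intros n Hn.
  apply Cn_mult; [apply (Cn_sub n U)|apply (Cn_sub n W)]; tauto || auto.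
Qed.

Lemma le_reg_0 k : le_reg 0 k.
Proof. destruct k; simpl; auto; lia. Qed.

Lemma le_reg_1 k : k <> Fin 0 -> le_reg 1 k.
Proof.
  destruct k as [[|n]|]; simpl; intros H; auto; [congruence|lia].
Qed.

Lemma Ckat_continuous k f x : Ckat k f x -> continuous f x.
Proof.
  intros [U [_ [Ux H]]]. apply (Cn_continuous 0 U); [apply H, le_reg_0|exact Ux].
Qed.

Lemma Ckat_ex_derive k f x : k <> Fin 0 -> Ckat k f x -> ex_derive f x.
Proof.
  intros hk [U [_ [Ux H]]]. destruct (H 1%nat (le_reg_1 k hk)) as [f' [D _]].
  exists (f' x). exact (D x Ux).
Qed.

Lemma Ckat_comp k f g x :
  Ckat k f (g x) -> Ckat k g x -> Ckat k (fun y => f (g y)) x.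
Proof.
  intros [W [HW [Wx Hf]]] [U [HU [Ux Hg]]].
  assert (HV : open (fun y => U y /\ W (g y))).
  { intros y [Uy Wy]. apply filter_and; [exact (HU y Uy)|].
    apply (Cn_continuous 0 U g y (Hg _ (le_reg_0 k)) Uy). exact (HW _ Wy). }
  exists (fun y => U y /\ W (g y)). split; [exact HV|]. split; [auto|].
  intros n Hn. apply (Cn_comp n _ W); [tauto|auto|].
  apply (Cn_sub n U); [tauto|auto].
Qed.

(** With w = G (s + h) - G s, the quotient w / h is the inverse of the difference quotient h / w of
    F at G s, and continuity of G makes w small with h. *)
Lemma is_derive_inverse (F G : R -> R) (s l : R) :
  continuous G s -> locally s (fun y => F (G y) = y) ->
  is_derive F (G s) l -> l <> 0 -> is_derive G s (/ l).
Proof.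
  intros CG E HF Hl.
  pose proof (locally_singleton _ _ E) as Es. simpl in Es.
  assert (Al : 0 < Rabs l) by (apply Rabs_pos_lt; exact Hl).
  apply is_derive_Reals. apply is_derive_Reals in HF.
  intros eps Heps.
  (* The first bound keeps |q| >= |l| / 2, hence |q l| >= l^2 / 2; the second then gives |l - q| /
     |q l| < eps. *)
  set (e := Rmin (Rabs l / 2) (eps * (l * l) / 4)).
  assert (ll : 0 < l * l) by nra.
  assert (He : 0 < e).
  { unfold e. apply Rmin_glb_lt; nra. }
  destruct (HF e He) as [d Hd].
  assert (CG' : locally s (fun y => Rabs (G y - G s) < d)).
  { apply (CG (fun z => Rabs (z - G s) < d)). exists d. intros z Hz. exact Hz. }
  destruct (filter_and _ _ E CG') as [r Hr].
  exists r. intros h Hh0 Hhr.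
  assert (Bh : ball s r (s + h)).
  { unfold ball; simpl; unfold AbsRing_ball, abs, minus, plus, opp; simpl.
    replace (s + h + - s) with h by ring. exact Hhr. }
  destruct (Hr _ Bh) as [E1 C1].
  set (w := G (s + h) - G s) in *.
  assert (Ew : G (s + h) = G s + w) by (unfold w; ring).
  assert (w0 : w <> 0).
  { intros w0. rewrite w0, Rplus_0_r in Ew. rewrite Ew in E1. lra. }
  specialize (Hd w w0 C1). rewrite <- Ew, E1, Es in Hd.
  replace (s + h - s) with h in Hd by ring.
  set (q := h / w) in *.
  assert (Hq : Rabs q >= Rabs l / 2).
  { assert (e <= Rabs l / 2) by apply Rmin_l.
    pose proof (Rabs_triang_inv l q). rewrite Rabs_minus_sym in Hd. lra. }
  assert (q0 : q <> 0).
  { intros q0. rewrite q0, Rabs_R0 in Hq. lra. }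
  replace (w / h - / l) with ((l - q) * / (q * l)).
  2:{ unfold q. field. auto. }
  rewrite Rabs_mult, Rabs_inv, Rabs_mult, Rabs_minus_sym.
  assert (P : 0 < Rabs q * Rabs l) by (apply Rmult_lt_0_compat; lra).
  apply (Rmult_lt_reg_r (Rabs q * Rabs l)); [exact P|].
  rewrite Rmult_assoc, Rinv_l by lra. rewrite Rmult_1_r.
  assert (e <= eps * (l * l) / 4) by apply Rmin_r.
  assert (Rabs l * Rabs l = l * l) by (rewrite <- Rabs_mult; apply Rabs_pos_eq; lra).
  assert (Rabs q * Rabs l >= l * l / 2) by nra.
  nra.
Qed.

(** Bootstrapping through G' = 1 / F'(G): if G is C^n, the right-hand side is C^n, so G is
    C^(n+1). *)
Lemma Cn_inverse n (U W : R -> Prop) F G :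
  open U -> (forall y, U y -> continuous G y) -> (forall y, U y -> W (G y)) ->
  (forall y, U y -> F (G y) = y) -> (forall t, W t -> Derive F t <> 0) ->
  (forall t, W t -> ex_derive F t) -> Cn n W F -> Cn n U G.
Proof.
  intros HU CG HW E Dn DF.
  induction n as [|n IH]; intros HF; [exact CG|].
  pose proof (IH (Cn_pred _ _ _ HF)) as Gn.
  destruct HF as [F' [HF HF']].
  assert (N : forall t, W t -> F' t <> 0).
  { intros t Ht. rewrite <- (is_derive_unique F t (F' t)); auto. }
  exists (fun y => / F' (G y)). split.
  - intros y Hy. apply (is_derive_inverse F G); auto.
    apply (filter_imp U); [exact E|exact (HU y Hy)].
  - apply Cn_inv; [auto|]. apply (Cn_comp n U W); auto.
Qed.

(** Continuity of the derivative keeps it nonzero on a neighbourhood V of G s; V is chosen before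
    the order n, so it serves all orders. *)
Lemma Ckat_inverse k F G s :
  k <> Fin 0 -> Ckat k F (G s) -> Derive F (G s) <> 0 ->
  locally s (fun y => continuous G y) -> locally s (fun y => F (G y) = y) ->
  Ckat k G s.
Proof.
  intros hk [W [HW [Ws HF]]] Dn CG E.
  assert (DF : forall t, W t -> ex_derive F t).
  { intros t Ht. apply (Ckat_ex_derive k); [exact hk|]. exists W. auto. }
  assert (CD : continuous (Derive F) (G s)).
  { apply (proj2 (Ck_on_Cn k W F HW) HF 1%nat (le_reg_1 k hk) (G s) Ws). }
  assert (HD : locally (G s) (fun t => Derive F t <> 0)).
  { apply (CD (fun u => u <> 0)). apply (open_neq 0). exact Dn. }
  destruct (locally_open_ex _ _ (filter_and _ _ HD (HW _ Ws))) as [V [HV [Vs HVW]]].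
  assert (CGs : continuous G s) by exact (locally_singleton _ _ CG).
  assert (VG : locally s (fun y => V (G y))) by exact (CGs V (HV _ Vs)).
  destruct (locally_open_ex s _ (filter_and _ _ VG (filter_and _ _ CG E)))
    as [U [HU [Us HUP]]].
  exists U. split; [exact HU|]. split; [exact Us|]. intros n Hn.
  apply (Cn_inverse n U V F G); auto.
  - intros y Hy. apply HUP, Hy.
  - intros y Hy. apply HUP, Hy.
  - intros y Hy. apply HUP, Hy.
  - intros t Ht. apply HVW, Ht.
  - intros t Ht. apply DF, HVW, Ht.
  - apply (Cn_sub n W); [intros t Ht; apply HVW, Ht|auto].
Qed.

(** * A smooth step function *)

(** Split exp u = exp (u/2) * exp (u/2): one factor dominates (u/2)^n by induction, the other
    dominates u/2. *)
Lemma pow_le_exp (n : nat) : exists C, 0 < C /\ forall u, 0 <= u -> u ^ n <= C * exp u.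
Proof.
  induction n as [|n [C [HC IH]]].
  - exists 1. split; [lra|]. intros u Hu. simpl.
    pose proof (exp_ineq1_le u). lra.
  - exists (2 ^ S n * C). split.
    { apply Rmult_lt_0_compat; [apply pow_lt; lra|exact HC]. }
    intros u Hu. replace u with (2 * (u / 2)) at 1 by field.
    rewrite Rpow_mult_distr, Rmult_assoc.
    apply Rmult_le_compat_l; [apply pow_le; lra|].
    replace (exp u) with (exp (u / 2) * exp (u / 2)) by (rewrite <- exp_plus; f_equal; field).
    pose proof (IH (u / 2) ltac:(lra)) as H1.
    pose proof (exp_ineq1_le (u / 2)) as H2.
    pose proof (pow_le (u / 2) n ltac:(lra)) as H3.
    simpl. apply Rle_trans with (exp (u / 2) * (C * exp (u / 2))); [|right; ring].
    apply Rmult_le_compat; lra.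
Qed.

(* The index n makes the family closed under differentiation, so that smoothness at 0
   is a plain induction. *)
Definition flat (n : nat) (t : R) : R :=
  if Rle_dec t 0 then 0 else / t ^ n * exp (- / t).

Lemma flat_neg n t : t <= 0 -> flat n t = 0.
Proof. intros H. unfold flat. destruct (Rle_dec t 0); [reflexivity|lra]. Qed.

Lemma flat_pos n t : 0 < t -> flat n t = / t ^ n * exp (- / t).
Proof. intros H. unfold flat. destruct (Rle_dec t 0); [lra|reflexivity]. Qed.

Lemma flat_gt0 n t : 0 < t -> 0 < flat n t.
Proof.
  intros H. rewrite flat_pos by exact H.
  apply Rmult_lt_0_compat; [apply Rinv_0_lt_compat, pow_lt, H|apply exp_pos].
Qed.

(** With u = / t this is u^(n+2) <= C * exp u. The quadratic bound is what makes the derivative at 0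
    vanish. *)
Lemma flat_bound n : exists C, 0 < C /\ forall t, Rabs (flat n t) <= C * (t * t).
Proof.
  destruct (pow_le_exp (n + 2)) as [C [HC H]]. exists C. split; [exact HC|].
  intros t. destruct (Rle_dec t 0) as [Ht|Ht].
  { rewrite flat_neg, Rabs_R0 by exact Ht. nra. }
  apply Rnot_le_lt in Ht. rewrite Rabs_pos_eq by (left; apply flat_gt0, Ht).
  rewrite flat_pos by exact Ht. rewrite exp_Ropp.
  assert (Hu : 0 < / t) by (apply Rinv_0_lt_compat, Ht).
  specialize (H (/ t) (Rlt_le _ _ Hu)). rewrite pow_add, pow_inv in H.
  pose proof (exp_pos (/ t)) as He.
  apply (Rmult_le_reg_r (exp (/ t))); [exact He|].
  rewrite Rmult_assoc, Rinv_l, Rmult_1_r by lra.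
  apply Rle_trans with ((/ t ^ n * (/ t) ^ 2) * (t * t)).
  - right. field. split; [|apply pow_nonzero]; lra.
  - replace (C * (t * t) * exp (/ t)) with (C * exp (/ t) * (t * t)) by ring.
    apply Rmult_le_compat_r; nra.
Qed.

(** For t > 0 this is the product rule for t^(-n) e^(-1/t). At 0 the difference quotient is at most
    C |h|, and the right-hand side is 0 there too. *)
Lemma flat_derive n t :
  is_derive (flat n) t (- INR n * flat (n + 1) t + flat (n + 2) t).
Proof.
  destruct (Rtotal_order t 0) as [Ht|[Ht|Ht]].
  - rewrite !flat_neg by lra.
    apply (is_derive_ext_loc (fun _ => 0)).
    + apply (filter_imp (fun u => u < 0)); [|exact (open_lt 0 t Ht)].
      intros u Hu. rewrite flat_neg; [reflexivity|lra].
    + replace (- INR n * 0 + 0) with 0 by ring.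
      apply (is_derive_const (K := R_AbsRing) (V := R_NormedModule) 0 t).
  - subst t. rewrite !flat_neg by lra.
    replace (- INR n * 0 + 0) with 0 by ring.
    apply is_derive_Reals. intros eps Heps.
    destruct (flat_bound n) as [C [HC HB]].
    exists (mkposreal (eps / C) (Rdiv_lt_0_compat _ _ Heps HC)). simpl.
    intros h Hh0 Hh. rewrite Rplus_0_l, (flat_neg n 0), !Rminus_0_r by lra.
    pose proof (Rabs_pos_lt h Hh0) as Ah.
    unfold Rdiv. rewrite Rabs_mult, Rabs_inv.
    apply (Rmult_lt_reg_r (Rabs h)); [exact Ah|].
    rewrite Rmult_assoc, Rinv_l, Rmult_1_r by lra.
    apply Rle_lt_trans with (C * (Rabs h * Rabs h)).
    + rewrite <- Rabs_mult, (Rabs_pos_eq (h * h)) by nra. apply HB.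
    + assert (C * Rabs h < eps).
      { apply (Rmult_lt_compat_l C) in Hh; [|exact HC].
        replace (C * (eps / C)) with eps in Hh by (field; lra). exact Hh. }
      nra.
  - apply (is_derive_ext_loc (fun u => / u ^ n * exp (- / u))).
    + apply (filter_imp (fun u => 0 < u)); [|exact (open_gt 0 t Ht)].
      intros u Hu. rewrite flat_pos; [reflexivity|exact Hu].
    + rewrite !flat_pos by exact Ht.
      pose proof (pow_nonzero t n ltac:(lra)) as Hn.
      auto_derive.
      * repeat split; auto; lra.
      * destruct n as [|n].
        { simpl. field. lra. }
        { rewrite !pow_add. simpl pred. simpl pow in Hn |- *. field.
          split; [lra|]. intros E. apply Hn. rewrite E. ring. }
Qed.

Lemma flat_Cn m n U : Cn m U (flat n).
Proof.
  revert n; induction m as [|m IH]; intros n.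
  - intros x _. exact (is_derive_continuous _ _ _ (flat_derive n x)).
  - exists (fun t => - INR n * flat (n + 1) t + flat (n + 2) t). split.
    + intros x _. apply flat_derive.
    + apply Cn_plus; [|apply IH]. apply Cn_mult; [apply Cn_const|apply IH].
Qed.

Lemma flat0_incr t u : t <= u -> flat 0 t <= flat 0 u.
Proof.
  intros H. destruct (Rle_dec t 0) as [Ht|Ht].
  - rewrite (flat_neg 0 t Ht). destruct (Rle_dec u 0) as [Hu|Hu].
    + rewrite flat_neg; lra.
    + left. apply flat_gt0. lra.
  - rewrite !flat_pos by lra. simpl. rewrite Rinv_1, !Rmult_1_l.
    destruct H as [H| <-]; [|lra]. left. apply exp_increasing.
    apply Ropp_lt_contravar, Rinv_lt_contravar; [nra|exact H].
Qed.

Lemma flat0_ge0 t : 0 <= flat 0 t.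
Proof.
  destruct (Rle_dec t 0) as [Ht|Ht]; [rewrite flat_neg; lra|].
  left. apply flat_gt0. lra.
Qed.

(** The usual smooth transition from 0 to 1; the denominator is positive because t and 1 - t are
    never both nonpositive. *)
Definition step (t : R) : R := flat 0 t * / (flat 0 t + flat 0 (1 - t)).

Lemma step_den t : 0 < flat 0 t + flat 0 (1 - t).
Proof.
  pose proof (flat0_ge0 t). pose proof (flat0_ge0 (1 - t)).
  destruct (Rle_dec t 0).
  - pose proof (flat_gt0 0 (1 - t)). lra.
  - pose proof (flat_gt0 0 t). lra.
Qed.

Lemma step_0 t : t <= 0 -> step t = 0.
Proof. intros H. unfold step. rewrite (flat_neg 0 t H). ring. Qed.

Lemma step_1 t : 1 <= t -> step t = 1.
Proof.
  intros H. unfold step. pose proof (step_den t) as D.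
  rewrite (flat_neg 0 (1 - t)) in * by lra. rewrite Rplus_0_r in *. field. lra.
Qed.

Lemma step_incr t u : t <= u -> step t <= step u.
Proof.
  intros H. unfold step.
  pose proof (step_den t) as Dt. pose proof (step_den u) as Du.
  pose proof (flat0_incr t u H). pose proof (flat0_incr (1 - u) (1 - t) ltac:(lra)).
  pose proof (flat0_ge0 t). pose proof (flat0_ge0 (1 - u)).
  apply (Rmult_le_reg_r (flat 0 t + flat 0 (1 - t))); [exact Dt|].
  rewrite Rmult_assoc, Rinv_l, Rmult_1_r by lra.
  apply (Rmult_le_reg_r (flat 0 u + flat 0 (1 - u))); [exact Du|].
  replace (flat 0 u * / (flat 0 u + flat 0 (1 - u)) * (flat 0 t + flat 0 (1 - t))
    * (flat 0 u + flat 0 (1 - u))) with (flat 0 u * (flat 0 t + flat 0 (1 - t)))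
    by (field; lra).
  (* The products [flat 0 t * flat 0 u] cancel, leaving [flat 0 t * flat 0 (1 - u) <= flat 0 u *
     flat 0 (1 - t)]. *)
  nra.
Qed.

Lemma step_Ckat k t : Ckat k step t.
Proof.
  exists (fun _ => True). split; [apply open_true|]. split; [exact I|]. intros n _.
  assert (H : Cn n (fun _ => True) (fun u => flat 0 (1 - u))).
  { apply (Cn_comp n _ (fun _ => True) (flat 0) (fun u => 1 - u)); [auto|apply flat_Cn|].
    apply (Cn_ext n _ (fun u => 1 + (-1) * u)); [apply open_true|intros; ring|].
    apply Cn_plus; [apply Cn_const|]. apply Cn_mult; [apply Cn_const|apply Cn_id]. }
  apply Cn_mult; [apply flat_Cn|]. apply Cn_inv.
  - intros x _. pose proof (step_den x). lra.
  - apply Cn_plus; [apply flat_Cn|exact H].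
Qed.

Lemma Derive_step_neq0 t : 0 < t < 1 -> Derive step t <> 0.
Proof.
  intros Ht. pose proof (step_den t) as D.
  pose proof (flat_derive 0 t) as D1.
  pose proof (flat_derive 0 (1 - t)) as D2.
  simpl in D1, D2. rewrite Ropp_0, Rmult_0_l, Rplus_0_l in D1, D2.
  pose proof (flat_gt0 0 t ltac:(lra)) as P1.
  pose proof (flat_gt0 0 (1 - t) ltac:(lra)) as P2.
  pose proof (flat_gt0 2 t ltac:(lra)) as P3.
  pose proof (flat_gt0 2 (1 - t) ltac:(lra)) as P4.
  assert (E : is_derive step t
    ((flat 2 t * flat 0 (1 - t) + flat 0 t * flat 2 (1 - t))
      / (flat 0 t + flat 0 (1 - t)) ^ 2)).
  { unfold step. auto_derive.
    - change (1 + - t) with (1 - t).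
      repeat split; try lra; eexists; eassumption.
    - replace (Derive (fun x => flat 0 x) t) with (flat 2 t)
        by (symmetry; apply is_derive_unique, D1).
      replace (Derive (fun x => flat 0 x) (1 + - t)) with (flat 2 (1 - t))
        by (symmetry; apply is_derive_unique, D2).
      change (1 + - t) with (1 - t).
      match goal with |- ?a = ?b => change (@eq R a b) end. field. lra. }
  rewrite (is_derive_unique _ _ _ E). apply Rgt_not_eq. unfold Rgt, Rdiv.
  apply Rmult_lt_0_compat; [nra|]. apply Rinv_0_lt_compat, pow_lt, D.
Qed.

(** * Global charts on the real line *)

Lemma locally_abs (x : R) (P : R -> Prop) :
  locally x P <-> exists d, 0 < d /\ forall y, Rabs (y - x) < d -> P y.
Proof.
  split.
  - intros [d Hd]. exists d. split; [apply cond_pos|]. intros y Hy. apply Hd. exact Hy.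
  - intros [d [Hd H]]. exists (mkposreal d Hd). intros y Hy. apply H. exact Hy.
Qed.

(* The segment from (a, b) to (y, z) stays in the half plane below the diagonal,
   where (y, z) |-> f z - f y does not vanish. *)
Lemma injective_continuous_increasing (f : R -> R) a b :
  (forall x, a <= x <= b -> continuous f x) ->
  (forall x y, a <= x <= b -> a <= y <= b -> f x = f y -> x = y) ->
  f a < f b -> forall y z, a <= y -> y < z -> z <= b -> f y < f z.
Proof.
  intros C Inj Hab y z Hy Hyz Hz.
  destruct (Rlt_le_dec (f y) (f z)) as [H|H]; [exact H|exfalso].
  assert (N : f y <> f z).
  { intros E. apply Inj in E; lra. }
  set (h := fun s => f (a + s * (y - a)) - f (b + s * (z - b))).
  assert (Ch : forall s, 0 <= s <= 1 -> continuity_pt h s).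
  { intros s Hs. apply continuity_pt_filterlim.
    assert (L : forall p q : R, continuous (fun s => p + s * q) s).
    { intros p q. apply (continuous_plus (fun _ => p) (fun s => s * q)).
      - apply continuous_const.
      - apply (continuous_mult (fun s => s) (fun _ => q)); [apply continuous_id|apply continuous_const]. }
    apply (continuous_minus (fun s => f (a + s * (y - a))) (fun s => f (b + s * (z - b)))).
    - apply (continuous_comp (fun s => a + s * (y - a)) f); [apply L|apply C; nra].
    - apply (continuous_comp (fun s => b + s * (z - b)) f); [apply L|apply C; nra]. }
  destruct (IVT_interv h 0 1 Ch) as [s [Hs E]].
  - lra.
  - unfold h. rewrite !Rmult_0_l, !Rplus_0_r. lra.
  - unfold h. replace (a + 1 * (y - a)) with y by ring.
    replace (b + 1 * (z - b)) with z by ring. lra.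
  - assert (E' : a + s * (y - a) = b + s * (z - b)).
    { apply Inj; [nra|nra|]. unfold h in E. lra. }
    nra.
Qed.

(** The factor e records the orientation of f; later formulas use e * f instead of splitting into
    two cases. *)
Lemma injective_continuous_monotone (f : R -> R) a b : a < b ->
  (forall x, a <= x <= b -> continuous f x) ->
  (forall x y, a <= x <= b -> a <= y <= b -> f x = f y -> x = y) ->
  exists e, e <> 0 /\ forall y z, a <= y -> y < z -> z <= b -> e * f y < e * f z.
Proof.
  intros Hab C Inj.
  destruct (Rtotal_order (f a) (f b)) as [H|[H|H]].
  - exists 1. split; [lra|]. intros y z Hy Hyz Hz. rewrite !Rmult_1_l.
    apply (injective_continuous_increasing f a b); assumption.
  - apply Inj in H; lra.
  - exists (-1). split; [lra|].
    apply (injective_continuous_increasing (fun x => -1 * f x) a b).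
    + intros x Hx. apply (continuous_mult (fun _ => -1) f); [apply continuous_const|auto].
    + intros x y Hx Hy E. apply Inj; [assumption|assumption|lra].
    + lra.
Qed.

Lemma derive_product_sign (F G : R -> R) t l m :
  is_derive F t l -> is_derive G t m ->
  locally t (fun u => 0 <= (F u - F t) * (G u - G t)) -> 0 <= l * m.
Proof.
  intros HF HG HP.
  destruct (Rle_lt_dec 0 (l * m)) as [H|H]; [exact H|exfalso].
  assert (l0 : 0 < Rabs l) by (apply Rabs_pos_lt; intros E; rewrite E in H; lra).
  assert (m0 : 0 < Rabs m) by (apply Rabs_pos_lt; intros E; rewrite E in H; lra).
  apply is_derive_Reals in HF, HG.
  (* A difference quotient closer to l than |l| has the sign of l, and likewise for m; so l * m < 0
     would make p * q negative. *)
  destruct (HF _ l0) as [d1 H1], (HG _ m0) as [d2 H2].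
  apply locally_abs in HP. destruct HP as [d3 [Hd3 H3]].
  set (h := Rmin (Rmin d1 d2) d3 / 2).
  pose proof (cond_pos d1) as Hd1. pose proof (cond_pos d2) as Hd2.
  assert (Hm : 0 < Rmin (Rmin d1 d2) d3).
  { apply Rmin_glb_lt; [apply Rmin_glb_lt|]; assumption. }
  pose proof (Rmin_l (Rmin d1 d2) d3). pose proof (Rmin_r (Rmin d1 d2) d3).
  pose proof (Rmin_l d1 d2). pose proof (Rmin_r d1 d2).
  assert (h0 : 0 < h) by (unfold h; lra).
  assert (Ah : Rabs h = h) by (apply Rabs_pos_eq; lra).
  specialize (H1 h ltac:(lra) ltac:(rewrite Ah; unfold h; lra)).
  specialize (H2 h ltac:(lra) ltac:(rewrite Ah; unfold h; lra)).
  specialize (H3 (t + h) ltac:(replace (t + h - t) with h by ring; rewrite Ah; unfold h; lra)).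
  set (p := (F (t + h) - F t) / h) in *. set (q := (G (t + h) - G t) / h) in *.
  assert (Hpq : 0 <= p * q).
  { replace (p * q) with ((F (t + h) - F t) * (G (t + h) - G t) * (/ h * / h))
      by (unfold p, q; field; lra).
    apply Rmult_le_pos; [exact H3|].
    assert (0 < / h) by (apply Rinv_0_lt_compat; lra). nra. }
  clearbody p q.
  unfold Rabs in *. destruct (Rcase_abs l), (Rcase_abs m), (Rcase_abs (p - l)),
    (Rcase_abs (q - m)); nra.
Qed.

(** * Monotone functions and compactness of intervals *)

Definition nondecreasing (K : R -> R) : Prop := forall y z, y <= z -> K y <= K z.

Lemma nondecreasing_plus K L :
  nondecreasing K -> nondecreasing L -> nondecreasing (fun x => K x + L x).
Proof. intros HK HL y z H. specialize (HK y z H). specialize (HL y z H). lra. Qed.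

(** Compactness as a supremum argument: a short interval around the supremum m of the endpoints
    reached from a shows that m is reached and that the process passes m unless it has already
    arrived at b. *)
Lemma interval_induction (Q : R -> R -> Prop) :
  (forall a b c, a <= b -> b <= c -> Q a b -> Q b c -> Q a c) ->
  (forall x, exists d, 0 < d /\ forall u v, x - d < u <= x -> x <= v < x + d -> Q u v) ->
  forall a b, a <= b -> Q a b.
Proof.
  intros Hadd Hloc a b Hab.
  set (E := fun x => a <= x <= b /\ Q a x).
  destruct (completeness E) as [m [Hub Hlub]].
  - exists b. intros x [Hx _]. lra.
  - exists a. split; [lra|]. destruct (Hloc a) as [d [Hd H]]. apply H; lra.
  - assert (Ea : E a).
    { split; [lra|]. destruct (Hloc a) as [d [Hd H]]. apply H; lra. }
    assert (Hm : a <= m <= b).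
    { split; [apply Hub, Ea|]. apply Hlub. intros x [Hx _]. lra. }
    destruct (Hloc m) as [d [Hd H]].
    assert (Hx : exists x, E x /\ m - d < x).
    { apply NNPP. intros N. assert (m <= m - d); [|lra].
      apply Hlub. intros x Ex. destruct (Rle_dec x (m - d)) as [|Hn]; [assumption|].
      exfalso. apply N. exists x. split; [exact Ex|lra]. }
    destruct Hx as [x [Ex Hxm]]. pose proof (Hub x Ex) as Hxm'.
    assert (Step : forall v, m <= v <= b -> v < m + d -> E v).
    { intros v Hv Hvd. split; [lra|]. apply (Hadd a x v); [apply Ex|lra|apply Ex|].
      apply H; lra. }
    destruct (Rlt_le_dec b (m + d)) as [Hb|Hb].
    + apply (Step b); lra.
    + exfalso. pose proof (Hub _ (Step (m + d / 2) ltac:(lra) ltac:(lra))). lra.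
Qed.

Lemma nat_above (x : R) : exists N, x < INR N.
Proof.
  destruct (archimed x) as [A _]. exists (Z.to_nat (up x)).
  destruct (Z.le_gt_cases 0 (up x)) as [H|H].
  - rewrite INR_IZR_INZ, Z2Nat.id by exact H. lra.
  - pose proof (pos_INR (Z.to_nat (up x))).
    apply IZR_lt in H. simpl in H. lra.
Qed.

(** By monotonicity M sends the open interval from L (M s - eps) to L (M s + eps), which contains s,
    into the eps-neighbourhood of M s. *)
Lemma strict_increasing_inverse_continuous (L M : R -> R) :
  (forall y z, y < z -> L y < L z) -> (forall s, L (M s) = s) -> forall s, continuous M s.
Proof.
  intros SL LM s. apply filterlim_locally. intros eps. pose proof (cond_pos eps) as He.
  pose proof (SL (M s - eps) (M s) ltac:(lra)) as H1.
  pose proof (SL (M s) (M s + eps) ltac:(lra)) as H2. rewrite LM in H1, H2.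
  apply (filter_imp (fun t => L (M s - eps) < t /\ t < L (M s + eps))).
  - intros t [A B]. apply Rabs_def1.
    + change (M t - M s < eps). destruct (Rlt_le_dec (M t - M s) eps) as [|N]; [assumption|].
      exfalso. assert (L (M s + eps) <= L (M t)); [|rewrite LM in *; lra].
      destruct (Req_dec (M s + eps) (M t)) as [->|Hne]; [lra|]. left. apply SL. lra.
    + change (- eps < M t - M s). destruct (Rlt_le_dec (- eps) (M t - M s)) as [|N]; [assumption|].
      exfalso. assert (L (M t) <= L (M s - eps)); [|rewrite LM in *; lra].
      destruct (Req_dec (M t) (M s - eps)) as [->|Hne]; [lra|]. left. apply SL. lra.
  - apply filter_and; [apply (open_gt (L (M s - eps)))|apply (open_lt (L (M s + eps)))]; assumption.
Qed.

(** Says that g ∘ f^(-1) is C^k at f x, without naming an inverse of f. *)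
Definition RCk (k : reg) (x : R) (f g : R -> R) : Prop :=
  exists F, Ckat k F (f x) /\ locally x (fun y => F (f y) = g y).

Lemma RCk_trans k x f g h : RCk k x f g -> RCk k x g h -> RCk k x f h.
Proof.
  intros [F [HF EF]] [G [HG EG]]. exists (fun t => G (F t)). split.
  - apply Ckat_comp; [|exact HF].
    rewrite (locally_singleton _ _ EF). exact HG.
  - apply (filter_imp (fun y => F (f y) = g y /\ G (g y) = h y)).
    + intros y [E1 E2]. rewrite E1. exact E2.
    + apply filter_and; assumption.
Qed.

Lemma RCk_ext k x f g h : locally x (fun y => g y = h y) -> RCk k x f g -> RCk k x f h.
Proof.
  intros E [F [HF EF]]. exists F. split; [exact HF|].
  apply (filter_imp (fun y => g y = h y /\ F (f y) = g y)).
  - intros y [E1 E2]. congruence.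
  - apply filter_and; assumption.
Qed.

(* [P x f] reads: f is a local chart of the structure around x. *)
Record chart_family (k : reg) (P : R -> (R -> R) -> Prop) : Prop := {
  cf_cover : forall x, exists f, P x f;
  cf_near : forall x f, P x f -> locally x (fun y => P y f);
  cf_cont : forall x f, P x f -> continuous f x;
  cf_inj : forall x f, P x f -> exists d, 0 < d /\
    forall y z, Rabs (y - x) < d -> Rabs (z - x) < d -> f y = f z -> y = z;
  cf_open : forall x f, P x f -> forall W : R -> Prop, locally x W ->
    locally (f x) (fun t => exists z, W z /\ f z = t);
  cf_compat : forall x f g, P x f -> P x g -> RCk k x f g }.

Definition smooth_at (k : reg) (P : R -> (R -> R) -> Prop) (K : R -> R) (x : R) : Prop :=
  forall f, P x f -> RCk k x f K.

(** One chart suffices here, while [smooth_at] quantifies over all charts: the nonzero derivative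
    then never has to be carried from chart to chart. *)
Definition regular_at (k : reg) (P : R -> (R -> R) -> Prop) (K : R -> R) (x : R) : Prop :=
  exists f F, P x f /\ Ckat k F (f x) /\ Derive F (f x) <> 0 /\
    locally x (fun y => F (f y) = K y).

Section GlobalChart.

Variables (k : reg) (P : R -> (R -> R) -> Prop).
Hypothesis hk : k <> Fin 0.
Hypothesis cf : chart_family k P.

Lemma smooth_at_of_chart K x f : P x f -> RCk k x f K -> smooth_at k P K x.
Proof.
  intros Hf H g Hg. apply (RCk_trans k x g f); [|exact H]. apply (cf_compat k P cf); assumption.
Qed.

Lemma smooth_at_of_regular_at K x : regular_at k P K x -> smooth_at k P K x.
Proof.
  intros [f [F [Hf [HF [_ E]]]]]. apply (smooth_at_of_chart K x f Hf). exists F. auto.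
Qed.

Lemma smooth_at_const c x : smooth_at k P (fun _ => c) x.
Proof.
  intros f _. exists (fun _ => c). split; [apply Ckat_const|].
  apply filter_forall. reflexivity.
Qed.

Lemma smooth_at_plus K L x :
  smooth_at k P K x -> smooth_at k P L x -> smooth_at k P (fun y => K y + L y) x.
Proof.
  intros HK HL f Hf. destruct (HK f Hf) as [F [HF EF]], (HL f Hf) as [G [HG EG]].
  exists (fun t => F t + G t). split; [apply Ckat_plus; assumption|].
  apply (filter_imp (fun y => F (f y) = K y /\ G (f y) = L y)).
  - intros y [E1 E2]. congruence.
  - apply filter_and; assumption.
Qed.

Lemma smooth_at_ext K L x :
  locally x (fun y => K y = L y) -> smooth_at k P K x -> smooth_at k P L x.
Proof. intros E H f Hf. apply (RCk_ext k x f K L E), H, Hf. Qed.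

Lemma regular_at_ext K L x :
  locally x (fun y => K y = L y) -> regular_at k P K x -> regular_at k P L x.
Proof.
  intros E [f [F [Hf [HF [HD EF]]]]]. exists f, F. repeat split; try assumption.
  apply (filter_imp (fun y => K y = L y /\ F (f y) = K y)).
  - intros y [E1 E2]. congruence.
  - apply filter_and; assumption.
Qed.

(* Two nondecreasing functions have derivatives of the same sign in any chart,
   whatever its orientation, so a nonzero one cannot be cancelled. *)
Lemma regular_at_plus K L x :
  nondecreasing K -> nondecreasing L -> regular_at k P K x -> smooth_at k P L x ->
  regular_at k P (fun y => K y + L y) x.
Proof.
  intros MK ML [f [F [Hf [HF [HD EF]]]]] HL.
  destruct (HL f Hf) as [G [HG EG]].
  exists f, (fun t => F t + G t).
  pose proof (Ckat_ex_derive k F _ hk HF) as DF.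
  pose proof (Ckat_ex_derive k G _ hk HG) as DG.
  split; [exact Hf|]. split; [apply Ckat_plus; assumption|]. split.
  - rewrite (Derive_plus F G) by assumption.
    assert (S : 0 <= Derive F (f x) * Derive G (f x)).
    { apply (derive_product_sign F G (f x)).
      - apply Derive_correct, DF.
      - apply Derive_correct, DG.
      - apply (filter_imp (fun t => exists z, (F (f z) = K z /\ G (f z) = L z) /\ f z = t)).
        + intros t [z [[E1 E2] E]]. rewrite <- E, E1, E2.
          rewrite (locally_singleton _ _ EF), (locally_singleton _ _ EG).
          destruct (Rle_dec x z) as [H|H].
          * specialize (MK x z H). specialize (ML x z H). nra.
          * specialize (MK z x ltac:(lra)). specialize (ML z x ltac:(lra)). nra.
        + apply (cf_open k P cf x f Hf (fun z => F (f z) = K z /\ G (f z) = L z)).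
          apply filter_and; assumption. }
    intros E. apply HD. nra.
  - apply (filter_imp (fun y => F (f y) = K y /\ G (f y) = L y)).
    + intros y [E1 E2]. congruence.
    + apply filter_and; assumption.
Qed.

(** Clamping y to [x0 - d, x0 + d] before applying the chart f makes K defined on all of R. It
    creates no corner: beyond the two ends [step] is already constant, so K agrees with T ∘ f on the
    larger interval of radius [del]. *)
Lemma local_step (x0 : R) :
  exists eta K, 0 < eta /\ nondecreasing K /\ (forall y, smooth_at k P K y) /\
  (forall y, y <= x0 - 1 -> K y = 0) /\ (forall y, x0 + 1 <= y -> K y = 1) /\
  (forall y, Rabs (y - x0) < eta -> regular_at k P K y).
Proof.
  destruct (cf_cover k P cf x0) as [f Hf].
  destruct (cf_inj k P cf x0 f Hf) as [d1 [Hd1 Inj]].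
  pose proof (cf_near k P cf x0 f Hf) as Near. apply locally_abs in Near.
  destruct Near as [d2 [Hd2 Near]].
  (* Halving makes all bounds strict, so the closed interval of radius [del] stays within reach of
     [Inj] and [Near]; [del < 1] leaves K constant beyond x0 - 1 and x0 + 1. *)
  set (del := Rmin 1 (Rmin d1 d2) / 2).
  assert (Hdel : 0 < del /\ del < 1 /\ del < d1 /\ del < d2).
  { unfold del. pose proof (Rmin_l 1 (Rmin d1 d2)). pose proof (Rmin_r 1 (Rmin d1 d2)).
    pose proof (Rmin_l d1 d2). pose proof (Rmin_r d1 d2).
    assert (0 < Rmin 1 (Rmin d1 d2)) by (repeat apply Rmin_glb_lt; lra). lra. }
  clearbody del. destruct Hdel as [Hdel [Hdel1 [Hdd1 Hdd2]]].
  assert (AB : forall y e, x0 - e <= y <= x0 + e -> e < d1 -> Rabs (y - x0) < d1).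
  { intros y e Hy He. apply Rabs_def1; lra. }
  destruct (injective_continuous_monotone f (x0 - del) (x0 + del)) as [e [He Inc]].
  { lra. }
  { intros y Hy. apply (cf_cont k P cf), Near, Rabs_def1; lra. }
  { intros y z Hy Hz. apply Inj; apply (AB _ del); lra. }
  set (d := del / 2).
  set (l := e * f (x0 - d)). set (r := e * f (x0 + d)).
  assert (Hlr : l < r) by (apply Inc; unfold d; lra).
  (* The oriented chart e * f is rescaled to run from 0 at x0 - d to 1 at x0 + d. *)
  set (T := fun t => step ((e * t - l) / (r - l))).
  set (clamp := fun y => Rmax (x0 - d) (Rmin (x0 + d) y)).
  assert (Hd : 0 < d < del) by (unfold d; lra).
  assert (clamp_mid : forall y, x0 - d <= y <= x0 + d -> clamp y = y).
  { intros y Hy. unfold clamp. rewrite Rmin_right by lra. apply Rmax_right; lra. }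
  assert (clamp_l : forall y, y <= x0 - d -> clamp y = x0 - d).
  { intros y Hy. unfold clamp. rewrite Rmin_right by lra. apply Rmax_left; lra. }
  assert (clamp_r : forall y, x0 + d <= y -> clamp y = x0 + d).
  { intros y Hy. unfold clamp. rewrite Rmin_left by lra. apply Rmax_right; lra. }
  assert (Inc' : forall y z, x0 - del <= y -> y <= z -> z <= x0 + del -> e * f y <= e * f z).
  { intros y z Hy [Hyz| ->] Hz; [left; apply Inc; assumption|right; reflexivity]. }
  assert (Tinc : forall u v, e * u <= e * v -> T u <= T v).
  { intros u v Huv. apply step_incr. unfold Rdiv.
    apply Rmult_le_compat_r; [left; apply Rinv_0_lt_compat; lra|lra]. }
  assert (T0 : forall u, e * u <= l -> T u = 0).
  { intros u Hu. apply step_0. unfold Rdiv.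
    pose proof (Rinv_0_lt_compat (r - l) ltac:(lra)). nra. }
  assert (T1 : forall u, r <= e * u -> T u = 1).
  { intros u Hu. apply step_1.
    apply (Rmult_le_reg_r (r - l)); [lra|]. unfold Rdiv.
    rewrite Rmult_assoc, Rinv_l by lra. lra. }
  assert (TC : forall t, Ckat k T t).
  { intros t. apply (Ckat_comp k step (fun t => (e * t - l) / (r - l))); [apply step_Ckat|].
    apply (Ckat_mult k (fun t => e * t - l) (fun _ => / (r - l))); [|apply Ckat_const].
    apply (Ckat_plus k (fun t => e * t) (fun _ => - l)); [|apply Ckat_const].
    apply Ckat_mult; [apply Ckat_const|apply Ckat_id]. }
  assert (TD : forall t, l < e * t < r -> Derive T t <> 0).
  { intros t Ht.
    assert (Hs : 0 < (e * t - l) / (r - l) < 1).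
    { pose proof (Rinv_0_lt_compat (r - l) ltac:(lra)) as Hi. unfold Rdiv. split.
      - apply Rmult_lt_0_compat; lra.
      - apply (Rmult_lt_reg_r (r - l)); [lra|]. rewrite Rmult_assoc, Rinv_l by lra. lra. }
    assert (E : is_derive T t (e / (r - l) * Derive step ((e * t - l) / (r - l)))).
    { apply (is_derive_comp step (fun t => (e * t - l) / (r - l))).
      - apply Derive_correct, (Ckat_ex_derive k); [exact hk|apply step_Ckat].
      - auto_derive; [auto|]. match goal with |- ?a = ?b => change (@eq R a b) end.
        field. lra. }
    rewrite (is_derive_unique _ _ _ E). apply Rmult_integral_contrapositive_currified.
    - unfold Rdiv. apply Rmult_integral_contrapositive_currified; [exact He|].
      apply Rinv_neq_0_compat. lra.
    - apply Derive_step_neq0, Hs. }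
  set (K := fun y => T (f (clamp y))).
  (* Between the clamping radius d and [del], monotonicity of e * f puts its value beyond l or r,
     where T is already 0 or 1. *)
  assert (KT : forall y, Rabs (y - x0) < del -> T (f y) = K y).
  { intros y Hy. apply Rabs_def2 in Hy. unfold K.
    destruct (Rle_dec y (x0 - d)) as [Hl|Hl].
    { rewrite (clamp_l y Hl), !T0; [reflexivity|right; reflexivity|apply Inc'; lra]. }
    destruct (Rle_dec (x0 + d) y) as [Hr|Hr].
    { rewrite (clamp_r y Hr), !T1; [reflexivity|right; reflexivity|apply Inc'; lra]. }
    rewrite clamp_mid by lra. reflexivity. }
  assert (near : forall y, Rabs (y - x0) < del ->
    locally y (fun z => T (f z) = K z)).
  { intros y Hy. apply locally_abs. exists (del - Rabs (y - x0)).
    split; [lra|]. intros z Hz. apply KT.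
    replace (z - x0) with ((z - y) + (y - x0)) by ring.
    pose proof (Rabs_triang (z - y) (y - x0)). lra. }
  exists d, K. split; [apply Hd|]. split; [|split; [|split; [|split]]].
  - intros y z Hyz. apply Tinc.
    assert (Hc : forall u, x0 - d <= clamp u <= x0 + d).
    { intros u. unfold clamp. split; [apply Rmax_l|]. apply Rmax_lub; [lra|apply Rmin_l]. }
    pose proof (Hc y). pose proof (Hc z).
    apply Inc'; [lra| |lra]. unfold clamp. apply Rle_max_compat_l.
    apply Rle_min_compat_l, Hyz.
  - intros y. destruct (Rlt_le_dec (Rabs (y - x0)) del) as [Hy|Hy].
    + apply (smooth_at_of_chart K y f); [apply Near; lra|]. exists T.
      split; [apply TC|apply near, Hy].
    + destruct (Rlt_le_dec y x0) as [Hx|Hx].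
      * rewrite Rabs_left in Hy by lra.
        apply (smooth_at_ext (fun _ => 0)); [|apply smooth_at_const].
        apply (filter_imp (fun z => z < x0 - d)).
        -- intros z Hz. unfold K. rewrite clamp_l, T0; [reflexivity|right; reflexivity|lra].
        -- apply (open_lt (x0 - d)). unfold d. lra.
      * rewrite Rabs_pos_eq in Hy by lra.
        apply (smooth_at_ext (fun _ => 1)); [|apply smooth_at_const].
        apply (filter_imp (fun z => x0 + d < z)).
        -- intros z Hz. unfold K. rewrite clamp_r, T1; [reflexivity|right; reflexivity|lra].
        -- apply (open_gt (x0 + d)). unfold d. lra.
  - intros y Hy. unfold K. rewrite clamp_l, T0; [reflexivity|right; reflexivity|unfold d; lra].
  - intros y Hy. unfold K. rewrite clamp_r, T1; [reflexivity|right; reflexivity|unfold d; lra].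
  - intros y Hy. pose proof Hy as Hy'. apply Rabs_def2 in Hy'.
    assert (d < del) by (unfold d; lra).
    exists f, T. split; [apply Near; lra|]. split; [apply TC|]. split.
    + apply TD. split; apply Inc; lra.
    + apply near. lra.
Qed.

(** The top value is left as [K (b + 1)] and only bounded below, because adding bumps adds their
    heights. *)
Definition bump (a b : R) (K : R -> R) : Prop :=
  nondecreasing K /\ (forall y, smooth_at k P K y) /\ (forall y, y <= a - 1 -> K y = 0) /\
  (forall y, b + 1 <= y -> K y = K (b + 1)) /\ 1 <= K (b + 1) /\
  (forall y, a <= y <= b -> regular_at k P K y).

Lemma bump_concat a b c K L : a <= b -> b <= c ->
  bump a b K -> bump b c L -> bump a c (fun x => K x + L x).
Proof.
  intros Hab Hbc [MK [SK [K0 [K1 [KP RK]]]]] [ML [SL [L0 [L1 [LP RL]]]]].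
  split; [apply nondecreasing_plus; assumption|]. split; [intros; apply smooth_at_plus; auto|].
  split; [|split; [|split]].
  - intros y Hy. rewrite K0, L0 by lra. ring.
  - intros y Hy. rewrite (K1 y), (K1 (c + 1)), (L1 y) by lra. reflexivity.
  - rewrite (K1 (c + 1)) by lra. lra.
  - intros y Hy. destruct (Rle_dec y b) as [H|H].
    + apply regular_at_plus; auto. apply RK. lra.
    + apply (regular_at_ext (fun y => L y + K y)).
      * apply filter_forall. intros z. ring.
      * apply regular_at_plus; auto. apply RL. lra.
Qed.

Lemma bump_exists a b : a <= b -> exists K, bump a b K.
Proof.
  apply (interval_induction (fun a b => exists K, bump a b K)).
  - intros x y z Hxy Hyz [K HK] [L HL]. exists (fun u => K u + L u).
    apply (bump_concat x y z); assumption.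
  - intros x. destruct (local_step x) as [eta [K [Heta [MK [SK [K0 [K1 RK]]]]]]].
    exists eta. split; [exact Heta|]. intros u v Hu Hv. exists K.
    split; [exact MK|]. split; [exact SK|]. split; [|split; [|split]].
    + intros y Hy. apply K0. lra.
    + intros y Hy. rewrite !K1 by lra. reflexivity.
    + rewrite K1 by lra. lra.
    + intros y Hy. apply RK, Rabs_def1; lra.
Qed.

(** The n-th summand of the global chart: vanishing for |y| <= n - 1 gives local finiteness, the
    bounds 1 and -1 far out give unboundedness, and the regular annuli n <= |y| <= n + 1 cover R. *)
Definition shell (n : nat) (K : R -> R) : Prop :=
  nondecreasing K /\ (forall y, smooth_at k P K y) /\
  (forall y, Rabs y <= INR n - 1 -> K y = 0) /\
  (forall y, INR n + 2 <= y -> 1 <= K y) /\ (forall y, y <= - INR n - 2 -> K y <= -1) /\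
  (forall y, INR n <= Rabs y <= INR n + 1 -> regular_at k P K y).

Lemma shell_exists n : exists K, shell n K.
Proof.
  pose proof (pos_INR n) as Hn.
  destruct (bump_exists (INR n) (INR n + 1)) as [G [MG [SG [G0 [G1 [GP RG]]]]]]; [lra|].
  destruct (bump_exists (- INR n - 1) (- INR n)) as [H [MH [SH [H0 [H1 [HP RH]]]]]]; [lra|].
  (* c is the plateau of the left step; subtracting it makes H vanish in the middle and drop to -c
     <= -1 on the far left. *)
  set (c := H (- INR n + 1)) in *.
  assert (ML : nondecreasing (fun y => H y + - c)) by (intros y z Hyz; specialize (MH y z Hyz); lra).
  assert (SL : forall y, smooth_at k P (fun y => H y + - c) y).
  { intros y. apply smooth_at_plus; [apply SH|apply smooth_at_const]. }
  exists (fun y => G y + (H y + - c)).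
  split; [apply nondecreasing_plus; assumption|]. split; [intros; apply smooth_at_plus; auto|].
  split; [|split; [|split]].
  - intros y Hy. pose proof (Rle_abs y). pose proof (Rle_abs (- y)) as H'.
    rewrite Rabs_Ropp in H'. rewrite G0, (H1 y) by lra. unfold c. ring.
  - intros y Hy. rewrite (H1 y), (G1 y) by lra. fold c. lra.
  - intros y Hy. rewrite G0, H0 by lra. lra.
  - intros y Hy. destruct (Rle_dec 0 y) as [Y|Y].
    + rewrite Rabs_pos_eq in Hy by exact Y. apply regular_at_plus; auto.
    + rewrite Rabs_left in Hy by lra.
      apply (regular_at_ext (fun y => (H y + - c) + G y)).
      { apply filter_forall. intros z. ring. }
      apply regular_at_plus; auto. apply regular_at_plus; auto.
      * intros u v _. lra.
      * apply RH. lra.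
      * apply smooth_at_const.
Qed.

Lemma shells_exist : exists K : nat -> R -> R, forall n, shell n (K n).
Proof.
  exists (fun n => proj1_sig (constructive_indefinite_description _ (shell_exists n))).
  intros n. apply (proj2_sig (constructive_indefinite_description _ (shell_exists n))).
Qed.

(** * The locally finite sum of the shells *)

Section Shells.

Variable K : nat -> R -> R.
Hypothesis HK : forall n, shell n (K n).

Definition partial_sum (N : nat) (y : R) : R := sum_f_R0 (fun n => K n y) N.

Lemma nondecreasing_partial_sum N : nondecreasing (partial_sum N).
Proof.
  induction N as [|N IH]; [exact (proj1 (HK 0))|].
  apply (nondecreasing_plus (partial_sum N) (K (S N))); [exact IH|apply HK].
Qed.

Lemma smooth_at_partial_sum N y : smooth_at k P (partial_sum N) y.
Proof.
  induction N as [|N IH]; [apply (HK 0)|].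
  apply (smooth_at_plus (partial_sum N) (K (S N))); [exact IH|apply HK].
Qed.

Lemma regular_at_partial_sum N y : Rabs y <= INR N + 1 -> regular_at k P (partial_sum N) y.
Proof.
  induction N as [|N IH]; intros Hy.
  - apply (HK 0). split; [apply Rabs_pos|exact Hy].
  - rewrite S_INR in Hy. destruct (Rle_dec (Rabs y) (INR N + 1)) as [H|H].
    + apply (regular_at_plus (partial_sum N) (K (S N))); [apply nondecreasing_partial_sum|apply HK|auto|apply HK].
    + apply (regular_at_ext (fun y => K (S N) y + partial_sum N y)).
      { apply filter_forall. intros z. apply Rplus_comm. }
      apply regular_at_plus; [apply HK|apply nondecreasing_partial_sum| |apply smooth_at_partial_sum].
      apply HK. rewrite S_INR. lra.
Qed.

Lemma partial_sum_stable N m y :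
  Rabs y <= INR N -> (N <= m)%nat -> partial_sum m y = partial_sum N y.
Proof.
  intros Hy Hm. induction Hm as [|m Hm IH]; [reflexivity|].
  unfold partial_sum in *. simpl. rewrite IH.
  destruct (HK (S m)) as [_ [_ [Z _]]]. rewrite Z; [ring|].
  rewrite S_INR. apply le_INR in Hm. lra.
Qed.

(** The infinite sum without a limit: [up (Rabs y)] exceeds |y|, and all shells of larger index
    vanish at y. *)
Definition total_sum (y : R) : R := partial_sum (Z.to_nat (up (Rabs y))) y.

Lemma total_sum_eq_partial_sum N y : Rabs y <= INR N -> total_sum y = partial_sum N y.
Proof.
  intros Hy. unfold total_sum.
  assert (HM : Rabs y <= INR (Z.to_nat (up (Rabs y)))).
  { destruct (archimed (Rabs y)) as [A _]. pose proof (Rabs_pos y).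
    rewrite INR_IZR_INZ, Z2Nat.id; [lra|]. apply le_IZR. simpl. lra. }
  set (M := Z.to_nat (up (Rabs y))) in *.
  rewrite <- (partial_sum_stable M (Nat.max M N) y HM ltac:(lia)).
  apply partial_sum_stable; [exact Hy|lia].
Qed.

Lemma nondecreasing_total_sum : nondecreasing total_sum.
Proof.
  intros y z Hyz. destruct (nat_above (Rmax (Rabs y) (Rabs z))) as [N HN].
  pose proof (Rmax_l (Rabs y) (Rabs z)). pose proof (Rmax_r (Rabs y) (Rabs z)).
  rewrite (total_sum_eq_partial_sum N y), (total_sum_eq_partial_sum N z) by lra. apply nondecreasing_partial_sum, Hyz.
Qed.

Lemma regular_at_total_sum y : regular_at k P total_sum y.
Proof.
  destruct (nat_above (Rabs y)) as [N HN].
  apply (regular_at_ext (partial_sum N)); [|apply regular_at_partial_sum; lra].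
  apply locally_abs. exists (INR N - Rabs y). split; [lra|]. intros z Hz.
  symmetry. apply total_sum_eq_partial_sum.
  replace z with ((z - y) + y) by ring. pose proof (Rabs_triang (z - y) y). lra.
Qed.

(** Keeps surplus terms from spoiling the growth estimate. It concerns [S n] because the vanishing
    clause is vacuous for shell 0, so [K 0] need not vanish at 0. *)
Lemma shell_sign n y : (0 <= y -> 0 <= K (S n) y) /\ (y <= 0 -> K (S n) y <= 0).
Proof.
  destruct (HK (S n)) as [M [_ [Z _]]].
  assert (Z0 : K (S n) 0 = 0).
  { apply Z. rewrite Rabs_R0, S_INR. pose proof (pos_INR n). lra. }
  split; intros Hy; specialize (M _ _ Hy); lra.
Qed.

Lemma total_sum_unbounded N :
  INR N + 1 <= total_sum (INR N + 2) /\ total_sum (- INR N - 2) <= - INR N - 1.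
Proof.
  pose proof (pos_INR N) as HN0.
  (* To evaluate at distance N + 2 the sum must run to index N + 2. Shells 0 to N contribute at
     least 1 each in absolute value, and the last two have the right sign. *)
  assert (E2 : INR (N + 2) = INR N + 2) by (rewrite plus_INR; simpl; ring).
  rewrite (total_sum_eq_partial_sum (N + 2) (INR N + 2)), (total_sum_eq_partial_sum (N + 2) (- INR N - 2)).
  2:{ rewrite Rabs_left by lra. lra. }
  2:{ rewrite Rabs_pos_eq by lra. lra. }
  assert (A : forall M y, INR M + 2 <= y -> INR M + 1 <= partial_sum M y).
  { induction M as [|M IH]; intros y Hy.
    - unfold partial_sum; simpl in *. pose proof (proj1 (proj2 (proj2 (proj2 (HK 0)))) y). simpl in *. lra.
    - rewrite S_INR in Hy |- *. specialize (IH y ltac:(lra)).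
      pose proof (proj1 (proj2 (proj2 (proj2 (HK (S M))))) y) as H.
      rewrite S_INR in H. unfold partial_sum in *. simpl. lra. }
  assert (B : forall M y, y <= - INR M - 2 -> partial_sum M y <= - INR M - 1).
  { induction M as [|M IH]; intros y Hy.
    - unfold partial_sum; simpl in *.
      pose proof (proj1 (proj2 (proj2 (proj2 (proj2 (HK 0))))) y). simpl in *. lra.
    - rewrite S_INR in Hy |- *. specialize (IH y ltac:(lra)).
      pose proof (proj1 (proj2 (proj2 (proj2 (proj2 (HK (S M)))))) y) as H.
      rewrite S_INR in H. unfold partial_sum in *. simpl. lra. }
  specialize (A N (INR N + 2) ltac:(lra)). specialize (B N (- INR N - 2) ltac:(lra)).
  replace (N + 2)%nat with (S (S N)) by lia. unfold partial_sum in *. simpl.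
  destruct (shell_sign N (INR N + 2)) as [S1 _], (shell_sign (S N) (INR N + 2)) as [S2 _].
  destruct (shell_sign N (- INR N - 2)) as [_ S3], (shell_sign (S N) (- INR N - 2)) as [_ S4].
  specialize (S1 ltac:(lra)). specialize (S2 ltac:(lra)).
  specialize (S3 ltac:(lra)). specialize (S4 ltac:(lra)). lra.
Qed.

End Shells.

(** * The global chart and its inverse *)

Lemma regular_at_continuous L x : regular_at k P L x -> continuous L x.
Proof.
  intros [f [F [Hf [HF [_ E]]]]].
  apply (continuous_ext_loc L (fun y => F (f y))); [exact E|].
  apply (continuous_comp f F); [apply (cf_cont k P cf), Hf|].
  apply (Ckat_continuous k), HF.
Qed.

Lemma regular_at_not_locally_constant L x c :
  regular_at k P L x -> ~ locally x (fun y => L y = c).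
Proof.
  intros [f [F [Hf [HF [HD E]]]]] Hc. apply HD.
  rewrite (Derive_ext_loc F (fun _ => c)); [apply Derive_const|].
  apply (filter_imp (fun t => exists z, (F (f z) = L z /\ L z = c) /\ f z = t)).
  - intros t [z [[E1 E2] <-]]. congruence.
  - apply (cf_open k P cf x f Hf (fun z => F (f z) = L z /\ L z = c)).
    apply filter_and; assumption.
Qed.

Lemma regular_at_strict L :
  nondecreasing L -> (forall x, regular_at k P L x) -> forall y z, y < z -> L y < L z.
Proof.
  intros ML RL y z Hyz.
  destruct (Rlt_le_dec (L y) (L z)) as [H|H]; [exact H|exfalso].
  apply (regular_at_not_locally_constant L ((y + z) / 2) (L y)); [apply RL|].
  apply locally_abs. exists ((z - y) / 2). split; [lra|]. intros u Hu.
  apply Rabs_def2 in Hu. pose proof (ML y u ltac:(lra)). pose proof (ML u z ltac:(lra)). lra.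
Qed.

Lemma global_chart : exists Phi Psi : R -> R,
  inverses Phi Psi /\ (forall x, continuous Phi x) /\ (forall y, continuous Psi y) /\
  Phi 0 = 0 /\ forall x f, P x f -> RCk k x f Phi /\ RCk k x Phi f.
Proof.
  destruct shells_exist as [K HK].
  set (c := total_sum K 0).
  set (Phi := fun y => total_sum K y + - c).
  assert (MPhi : nondecreasing Phi).
  { intros y z Hyz. pose proof (nondecreasing_total_sum K HK y z Hyz). unfold Phi. lra. }
  assert (RPhi : forall x, regular_at k P Phi x).
  { intros x. apply regular_at_plus; [apply nondecreasing_total_sum, HK|intros u v _; lra|apply regular_at_total_sum, HK|].
    apply smooth_at_const. }
  assert (CPhi : forall x, continuous Phi x) by (intros x; apply regular_at_continuous, RPhi).
  pose proof (regular_at_strict Phi MPhi RPhi) as SPhi.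
  assert (Surj : forall s, exists x, Phi x = s).
  { intros s. destruct (nat_above (Rabs (s + c))) as [N HN]. apply Rabs_def2 in HN.
    destruct (total_sum_unbounded K HK N) as [U1 U2].
    destruct (IVT_gen Phi (- INR N - 2) (INR N + 2) s) as [x [_ Hx]].
    - intros x. apply continuity_pt_filterlim, CPhi.
    - split.
      + apply Rle_trans with (Phi (- INR N - 2)); [apply Rmin_l|]. unfold Phi. lra.
      + apply Rle_trans with (Phi (INR N + 2)); [unfold Phi; lra|apply Rmax_r].
    - exists x. exact Hx. }
  set (Psi := fun s => proj1_sig (constructive_indefinite_description _ (Surj s))).
  assert (PhiPsi : forall s, Phi (Psi s) = s).
  { intros s. exact (proj2_sig (constructive_indefinite_description _ (Surj s))). }
  clearbody Psi.
  assert (PsiPhi : forall x, Psi (Phi x) = x).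
  { intros x. destruct (Rtotal_order (Psi (Phi x)) x) as [H|[H|H]]; [|exact H|];
      apply SPhi in H; rewrite PhiPsi in H; lra. }
  pose proof (strict_increasing_inverse_continuous Phi Psi SPhi PhiPsi) as CPsi.
  exists Phi, Psi. split; [intros x; split; auto|]. split; [exact CPhi|].
  split; [exact CPsi|]. split; [unfold Phi, c; ring|]. intros x f Hf.
  split; [apply (smooth_at_of_regular_at Phi x (RPhi x) f Hf)|].
  destruct (RPhi x) as [g [G [Hg [HG [HD EG]]]]].
  (* Only one chart g, in which Phi is regular, has to be expressed through Phi: from G ∘ g = Phi
     near x, g ∘ Psi is a continuous local right inverse of G. Compatibility then reaches f. *)
  apply (RCk_trans k x Phi g); [|apply (cf_compat k P cf); assumption].
  exists (fun s => g (Psi s)). split.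
  - apply (Ckat_inverse k G (fun s => g (Psi s))); rewrite ?PsiPhi; try assumption.
    + assert (H : locally (Phi x) (fun s => P (Psi s) g)).
      { apply (CPsi (Phi x) (fun y => P y g)). rewrite PsiPhi.
        apply (cf_near k P cf), Hg. }
      revert H. apply filter_imp. intros s Hs.
      apply (continuous_comp Psi g); [apply CPsi|apply (cf_cont k P cf), Hs].
    + assert (H : locally (Phi x) (fun s => G (g (Psi s)) = Phi (Psi s))).
      { apply (CPsi (Phi x) (fun y => G (g y) = Phi y)). rewrite PsiPhi. exact EG. }
      revert H. apply filter_imp. intros s Hs. rewrite Hs. apply PhiPsi.
  - apply filter_forall. intros y. rewrite PsiPhi. reflexivity.
Qed.

End GlobalChart.

(** * Charts on the line with two origins *)

(* The two copies of R in L are treated uniformly: [true] stands for U with its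
   origin [pt 0], [false] for V with its origin [origin'], so that
   [dom true] is [Uset] and [dom false] is [Vset] up to conversion. *)
Definition org (b : bool) : L := if b then pt 0 else origin'.
Definition dom (b : bool) : L -> Prop := fun p => p <> org (negb b).
Definition emb (b : bool) : R -> L := if b then pt else sw.
Definition proj (p : L) : R := match p with pt x => x | origin' => 0 end.

Lemma sw_0 : sw 0 = origin'.
Proof. unfold sw. destruct (Req_EM_T 0 0); [reflexivity|congruence]. Qed.

Lemma sw_neq0 x : x <> 0 -> sw x = pt x.
Proof. intros H. unfold sw. destruct (Req_EM_T x 0); [congruence|reflexivity]. Qed.

Lemma emb_0 b : emb b 0 = org b.
Proof. destruct b; [reflexivity|apply sw_0]. Qed.

Lemma emb_neq0 b x : x <> 0 -> emb b x = pt x.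
Proof. intros H. destruct b; [reflexivity|apply sw_neq0, H]. Qed.

Lemma proj_emb b x : proj (emb b x) = x.
Proof.
  destruct (Req_dec x 0) as [->|H]; [rewrite emb_0; destruct b; reflexivity|].
  rewrite emb_neq0 by exact H. reflexivity.
Qed.

Lemma pt_dom b x : x <> 0 -> dom b (pt x).
Proof. intros H E. destruct b; simpl in E; congruence. Qed.

Lemma org_dom b : dom b (org b).
Proof. destruct b; discriminate. Qed.

Lemma dom_emb b x : dom b (emb b x).
Proof.
  destruct (Req_dec x 0) as [->|H]; [rewrite emb_0; apply org_dom|].
  rewrite emb_neq0 by exact H. apply pt_dom, H.
Qed.

Lemma emb_proj b p : dom b p -> emb b (proj p) = p.
Proof.
  intros H. destruct p as [x|]; simpl.
  - destruct (Req_dec x 0) as [->|Hx]; [|apply emb_neq0, Hx].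
    rewrite emb_0. destruct b; [reflexivity|]. contradiction H; reflexivity.
  - rewrite emb_0. destruct b; [contradiction H|]; reflexivity.
Qed.

Lemma dom_negb b p : dom (negb b) p <-> p <> org b.
Proof. unfold dom. rewrite Bool.negb_involutive. tauto. Qed.

Lemma dom_cover p : dom true p \/ dom false p.
Proof. destruct p as [x|]; [left|right]; discriminate. Qed.

Lemma dom_both b p : dom b p -> dom (negb b) p -> exists x, x <> 0 /\ p = pt x.
Proof.
  intros H H'. destruct p as [x|].
  - exists x. split; [|reflexivity]. intros ->. destruct b; contradiction.
  - destruct b; contradiction.
Qed.

Lemma openL_emb S : openL S <-> forall b, open (fun x => S (emb b x)).
Proof.
  split.
  - intros [H1 H2] [|]; assumption.
  - intros H. split; [exact (H true)|exact (H false)].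
Qed.

Lemma openL_and S T : openL S -> openL T -> openL (fun p => S p /\ T p).
Proof.
  intros [S1 S2] [T1 T2]. split.
  - apply (open_and (fun x => S (pt x)) (fun x => T (pt x))); assumption.
  - apply (open_and (fun x => S (sw x)) (fun x => T (sw x))); assumption.
Qed.

Lemma openL_dom b : openL (dom b).
Proof.
  apply openL_emb. intros c. destruct (Bool.bool_dec c b) as [->|H].
  - apply (open_ext (fun _ => True)); [|apply open_true].
    intros x. split; [intros _; apply dom_emb|auto].
  - apply (open_ext (fun x => x <> 0)); [|apply open_neq].
    intros x. split; intros Hx.
    + rewrite emb_neq0 by exact Hx. apply pt_dom, Hx.
    + intros ->. rewrite emb_0 in Hx. apply Hx. destruct b, c; reflexivity || congruence.
Qed.

Lemma openL_proj W : open W -> openL (fun p => W (proj p)).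
Proof.
  intros HW. apply openL_emb. intros b. apply (open_ext W); [|exact HW].
  intros x. rewrite proj_emb. tauto.
Qed.

(** * Germs and coordinate expressions on L *)

Definition locL (p : L) (Q : L -> Prop) : Prop :=
  exists S, openL S /\ S p /\ forall q, S q -> Q q.

Lemma locL_and p Q T : locL p Q -> locL p T -> locL p (fun q => Q q /\ T q).
Proof.
  intros [S [HS [Sp H]]] [S' [HS' [Sp' H']]]. exists (fun q => S q /\ S' q).
  split; [apply openL_and; assumption|]. split; [auto|]. intros q [A B]. auto.
Qed.

Lemma locL_imp p (Q T : L -> Prop) : (forall q, Q q -> T q) -> locL p Q -> locL p T.
Proof. intros H [S [HS [Sp HQ]]]. exists S. auto. Qed.

Lemma locL_singleton p Q : locL p Q -> Q p.
Proof. intros [S [_ [Sp H]]]. auto. Qed.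

(** [emb b] is a homeomorphism onto the open set [dom b], so local questions on L, even at an
    origin, become local questions on R. *)
Lemma locL_emb b x Q : locL (emb b x) Q <-> locally x (fun y => Q (emb b y)).
Proof.
  split.
  - intros [S [HS [Sx H]]]. apply (filter_imp (fun y => S (emb b y))); [auto|].
    apply (proj1 (openL_emb S) HS b x Sx).
  - intros H. destruct (locally_open_ex x _ H) as [W [HW [Wx HQ]]].
    exists (fun p => dom b p /\ W (proj p)).
    split; [apply openL_and; [apply openL_dom|apply openL_proj, HW]|].
    split; [split; [apply dom_emb|rewrite proj_emb; exact Wx]|].
    intros q [Dq Wq]. rewrite <- (emb_proj b q Dq). apply HQ, Wq.
Qed.

Lemma openL_of_locL S : (forall p, S p -> locL p S) -> openL S.
Proof.
  intros H. apply openL_emb. intros b x Sx. apply (locL_emb b x S), H, Sx.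
Qed.

(* Taking chi of the form chi' o f also covers maps f of L. *)
Definition LCk (k : reg) (p : L) (phi chi : L -> R) : Prop :=
  exists F, Ckat k F (phi p) /\ locL p (fun q => F (phi q) = chi q).

Lemma LCk_emb k b x phi chi :
  LCk k (emb b x) phi chi <-> RCk k x (fun y => phi (emb b y)) (fun y => chi (emb b y)).
Proof.
  split; intros [F [HF E]]; exists F; (split; [exact HF|]).
  - apply (locL_emb b x (fun q => F (phi q) = chi q)), E.
  - apply locL_emb, E.
Qed.

Lemma LCk_trans k p phi chi xi : LCk k p phi chi -> LCk k p chi xi -> LCk k p phi xi.
Proof.
  intros [F [HF EF]] [G [HG EG]]. exists (fun t => G (F t)). split.
  - apply Ckat_comp; [|exact HF]. rewrite (locL_singleton _ _ EF). exact HG.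
  - apply (locL_imp p (fun q => F (phi q) = chi q /\ G (chi q) = xi q)).
    + intros q [E1 E2]. rewrite E1. exact E2.
    + apply locL_and; assumption.
Qed.

Lemma LCk_pull k f p phi chi : contL f ->
  LCk k (f p) phi chi -> LCk k p (fun q => phi (f q)) (fun q => chi (f q)).
Proof.
  intros Hf [F [HF [S [HS [Sp E]]]]]. exists F. split; [exact HF|].
  exists (fun q => S (f q)). split; [apply Hf, HS|]. split; [exact Sp|].
  intros q Sq. apply E, Sq.
Qed.

Lemma chart_image_open D phi E : is_chart D phi -> openL E ->
  open (imageR (fun p => D p /\ E p) phi).
Proof.
  intros [HD [_ [_ [_ HO]]]] HE. apply HO; [apply openL_and; assumption|tauto].
Qed.

Lemma chart_injective D phi : is_chart D phi ->
  forall p q, D p -> D q -> phi p = phi q -> p = q.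
Proof. intros [_ [_ [H _]]]. exact H. Qed.

(** Injectivity of phi leaves only one candidate chi ∘ phi^(-1), so local expressions agree with it
    and no partition of unity is needed. A map f is covered by taking E = f^(-1)(D2) and chi = phi2
    ∘ f. *)
Lemma LCk_glue k D phi E chi : is_chart D phi -> openL E ->
  (forall p, D p -> E p -> LCk k p phi chi) ->
  exists F, Ck_on k (imageR (fun p => D p /\ E p) phi) F /\
    forall p, D p -> E p -> F (phi p) = chi p.
Proof.
  intros C HE H.
  set (pick := fun t => epsilon (inhabits origin') (fun p => (D p /\ E p) /\ phi p = t)).
  assert (Hpick : forall p, D p -> E p -> pick (phi p) = p).
  { intros p Dp Ep.
    assert (S : (D (pick (phi p)) /\ E (pick (phi p))) /\ phi (pick (phi p)) = phi p).
    { apply (epsilon_spec (inhabits origin') (fun q => (D q /\ E q) /\ phi q = phi p)).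
      exists p. auto. }
    apply (chart_injective D phi C); tauto. }
  exists (fun t => chi (pick t)). split.
  2:{ intros p Dp Ep. rewrite Hpick by assumption. reflexivity. }
  apply Ck_on_Ckat; [apply chart_image_open; assumption|].
  intros t [p [[Dp Ep] <-]]. destruct (H p Dp Ep) as [G [HG [S [HS [Sp EG]]]]].
  apply (Ckat_ext k G); [|exact HG].
  apply (filter_imp (imageR (fun q => D q /\ (E q /\ S q)) phi)).
  - intros t [q [[Dq [Eq Sq]] <-]]. rewrite Hpick by assumption. apply EG, Sq.
  - apply (chart_image_open D phi (fun q => E q /\ S q)); [exact C|apply openL_and; assumption|].
    exists p. auto.
Qed.

Lemma LCk_of_global k D phi E chi F p : is_chart D phi -> openL E ->
  Ck_on k (imageR (fun p => D p /\ E p) phi) F ->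
  (forall p, D p -> E p -> F (phi p) = chi p) -> D p -> E p -> LCk k p phi chi.
Proof.
  intros C HE HF H Dp Ep. exists F. split.
  - apply (proj1 (Ck_on_Ckat k _ F (chart_image_open D phi E C HE)) HF). exists p. auto.
  - exists (fun q => D q /\ E q). split; [apply openL_and; [apply C|exact HE]|].
    split; [auto|]. intros q [Dq Eq]. auto.
Qed.

Lemma compat_LCk k D1 phi1 D2 phi2 p : is_chart D1 phi1 -> is_chart D2 phi2 ->
  compat k D1 phi1 D2 phi2 -> D1 p -> D2 p -> LCk k p phi1 phi2 /\ LCk k p phi2 phi1.
Proof.
  intros C1 C2 [H|[[F [HF EF]] [G [HG EG]]]] H1 H2.
  { contradiction (H p). auto. }
  split.
  - apply (LCk_of_global k D1 phi1 D2 phi2 F); auto. apply C2.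
  - apply (LCk_of_global k D2 phi2 D1 phi1 G); auto. apply C1.
Qed.

Lemma compat_of_LCk k D1 phi1 D2 phi2 : is_chart D1 phi1 -> is_chart D2 phi2 ->
  (forall p, D1 p -> D2 p -> LCk k p phi1 phi2 /\ LCk k p phi2 phi1) ->
  compat k D1 phi1 D2 phi2.
Proof.
  (* Disjoint domains need no separate case: the conditions on the transition functions are then
     vacuous. *)
  intros C1 C2 H. right. split.
  - apply LCk_glue; [exact C1|apply C2|]. intros p H1 H2. apply H; assumption.
  - apply LCk_glue; [exact C2|apply C1|]. intros p H2 H1. apply H; assumption.
Qed.

Lemma inS_member k A D phi : atlas k A -> A D phi -> inS k A D phi.
Proof.
  intros [HC [HK _]] H. split; [apply HC, H|]. intros D' phi' H'. apply HK; assumption.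
Qed.

(** Both charts are compared with a chart of A around p; this is how compatibility becomes
    transitive. *)
Lemma inS_LCk k A D phi D' phi' p : atlas k A -> inS k A D phi -> inS k A D' phi' ->
  D p -> D' p -> LCk k p phi phi'.
Proof.
  intros [HC [HK HV]] [C H] [C' H'] Dp Dp'.
  destruct (HV p) as [E [chi [HE Ep]]].
  apply (LCk_trans k p phi chi).
  - apply (compat_LCk k D phi E chi p); auto.
  - apply (compat_LCk k D' phi' E chi p); auto.
Qed.

Lemma inS_compat k A D phi D' phi' : atlas k A -> inS k A D phi -> inS k A D' phi' ->
  compat k D phi D' phi'.
Proof.
  intros HA H H'. apply compat_of_LCk; [apply H|apply H'|].
  intros p Dp Dp'. split; [apply (inS_LCk k A D phi D' phi')|apply (inS_LCk k A D' phi' D phi)];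
    assumption.
Qed.

Lemma chart_continuous D phi b x : is_chart D phi -> D (emb b x) ->
  continuous (fun y => phi (emb b y)) x.
Proof.
  intros [_ [_ [_ [HC _]]]] Dx V HV.
  destruct (locally_open_ex _ _ HV) as [O [HO [Ox HOV]]].
  change (locally x (fun y => V (phi (emb b y)))).
  apply (filter_imp (fun y => D (emb b y) /\ O (phi (emb b y)))).
  - intros y [_ Hy]. exact (HOV _ Hy).
  - apply (proj1 (openL_emb _) (HC O HO) b x). auto.
Qed.

Lemma chart_open_map D phi b x (W : R -> Prop) : is_chart D phi -> D (emb b x) ->
  locally x W -> locally (phi (emb b x)) (fun t => exists z, W z /\ phi (emb b z) = t).
Proof.
  intros C Dx HW.
  assert (HL : locL (emb b x) (fun q => W (proj q))).
  { apply locL_emb. revert HW. apply filter_imp. intros y Hy. rewrite proj_emb. exact Hy. }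
  destruct HL as [S [HS [Sx H]]].
  apply (filter_imp (imageR (fun q => D q /\ (dom b q /\ S q)) phi)).
  - intros t [q [[Dq [Bq Sq]] <-]]. exists (proj q). split; [apply H, Sq|].
    rewrite (emb_proj b q Bq). reflexivity.
  - apply (chart_image_open D phi (fun q => dom b q /\ S q)); [exact C| |].
    + apply openL_and; [apply openL_dom|exact HS].
    + exists (emb b x). split; [|reflexivity]. split; [exact Dx|]. split; [apply dom_emb|exact Sx].
Qed.

(** An atlas of L restricts to each copy of R, which makes [global_chart] available for both. *)
Lemma atlas_chart_family k A b : atlas k A ->
  chart_family k (fun x f => exists D phi, A D phi /\ D (emb b x) /\
    f = (fun y => phi (emb b y))).
Proof.
  intros [HC [HK HV]]. split.
  - intros x. destruct (HV (emb b x)) as [D [phi [HA Dx]]].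
    exists (fun y => phi (emb b y)), D, phi. auto.
  - intros x f [D [phi [HA [Dx ->]]]].
    apply (filter_imp (fun y => D (emb b y))).
    + intros y Dy. exists D, phi. auto.
    + apply (proj1 (openL_emb D) (proj1 (HC D phi HA)) b x Dx).
  - intros x f [D [phi [HA [Dx ->]]]]. apply (chart_continuous D); auto.
  - intros x f [D [phi [HA [Dx ->]]]].
    pose proof (proj1 (openL_emb D) (proj1 (HC D phi HA)) b x Dx) as HD.
    apply locally_abs in HD. destruct HD as [d [Hd HD]]. exists d. split; [exact Hd|].
    intros y z Hy Hz E. apply (chart_injective D phi (HC D phi HA)) in E; auto.
    rewrite <- (proj_emb b y), E. apply proj_emb.
  - intros x f [D [phi [HA [Dx ->]]]] W HW. apply (chart_open_map D); auto.
  - intros x f g [D [phi [HA [Dx ->]]]] [D' [phi' [HA' [Dx' ->]]]].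
    apply LCk_emb. apply (compat_LCk k D phi D' phi'); auto.
Qed.

Lemma homeo_chart b Phi Psi : inverses Phi Psi -> (forall x, continuous Phi x) ->
  (forall y, continuous Psi y) -> is_chart (dom b) (fun p => Phi (proj p)).
Proof.
  intros HI CPhi CPsi. split; [apply openL_dom|]. split; [|split; [|split]].
  - apply (open_ext (fun _ => True)); [|apply open_true].
    intros y. split; [intros _|auto]. exists (emb b (Psi y)).
    split; [apply dom_emb|]. rewrite proj_emb. apply HI.
  - intros p q Dp Dq E. rewrite <- (emb_proj b p Dp), <- (emb_proj b q Dq).
    f_equal. rewrite <- (proj1 (HI (proj p))), E. apply HI.
  - intros O HO. apply openL_and; [apply openL_dom|].
    apply (openL_proj (fun x => O (Phi x))). apply open_comp; [|exact HO].
    intros x _. apply CPhi.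
  - intros S HS HD. apply (open_ext (fun y => S (emb b (Psi y)))).
    + intros y. split.
      * intros Sy. exists (emb b (Psi y)). split; [exact Sy|]. rewrite proj_emb. apply HI.
      * intros [p [Sp <-]]. rewrite (proj1 (HI (proj p))), (emb_proj b p (HD p Sp)). exact Sp.
    + apply (open_comp Psi (fun x => S (emb b x))); [intros x _; apply CPsi|].
      apply (proj1 (openL_emb S) HS b).
Qed.

(** * Minimal atlases inside a given structure *)

Lemma structure_chart k A b : k <> Fin 0 -> atlas k A ->
  exists phi, inS k A (dom b) phi /\ (forall y, exists p, dom b p /\ phi p = y) /\
    phi (org b) = 0.
Proof.
  intros hk HA.
  destruct (global_chart k _ hk (atlas_chart_family k A b HA))
    as [Phi [Psi [HI [CPhi [CPsi [Phi0 HR]]]]]].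
  pose proof (homeo_chart b Phi Psi HI CPhi CPsi) as HC.
  exists (fun p => Phi (proj p)). split; [|split].
  - split; [exact HC|]. intros D phi HD.
    apply compat_of_LCk; [exact HC|apply HA, HD|]. intros p Bp Dp.
    rewrite <- (emb_proj b p Bp) in Dp |- *.
    destruct (HR (proj p) (fun y => phi (emb b y))) as [R1 R2].
    { exists D, phi. auto. }
    assert (E : (fun y => Phi (proj (emb b y))) = Phi).
    { apply functional_extensionality. intros y. rewrite proj_emb. reflexivity. }
    split; apply LCk_emb; rewrite E; assumption.
  - intros y. exists (emb b (Psi y)). split; [apply dom_emb|]. rewrite proj_emb. apply HI.
  - rewrite <- (emb_0 b), proj_emb. exact Phi0.
Qed.

Lemma Mat_atlas k A phi psi : atlas k A ->
  inS k A (dom true) phi -> inS k A (dom false) psi -> atlas k (Mat phi psi).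
Proof.
  intros HA H1 H2.
  assert (HS : forall D chi, Mat phi psi D chi -> inS k A D chi).
  { intros D chi [[-> ->]|[-> ->]]; assumption. }
  split; [intros D chi H; apply HS, H|]. split.
  - intros D chi D' chi' H H'. apply (inS_compat k A); auto.
  - intros p. destruct (dom_cover p) as [H|H].
    + exists (dom true), phi. split; [left; auto|exact H].
    + exists (dom false), psi. split; [right; auto|exact H].
Qed.

Lemma equiv_atlas_of_inS k A B : atlas k A ->
  (forall D phi, B D phi -> inS k A D phi) -> equiv_atlas k A B.
Proof.
  intros HA HB.
  assert (HS : forall D phi, A D phi \/ B D phi -> inS k A D phi).
  { intros D phi [H|H]; [apply inS_member; assumption|apply HB, H]. }
  split; [intros D phi H; apply HS, H|]. split.
  - intros D phi D' phi' H H'. apply (inS_compat k A); auto.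
  - intros p. destruct HA as [_ [_ HV]]. destruct (HV p) as [D [phi [H Dp]]].
    exists D, phi. auto.
Qed.

Lemma minimal_atlas_exists k A : k <> Fin 0 -> atlas k A ->
  exists phi psi, minimal_atlas k phi psi /\ equiv_atlas k A (Mat phi psi).
Proof.
  intros hk HA.
  destruct (structure_chart k A true hk HA) as [phi [H1 [S1 Z1]]].
  destruct (structure_chart k A false hk HA) as [psi [H2 [S2 Z2]]].
  exists phi, psi. split.
  - split; [apply (Mat_atlas k A); assumption|]. repeat split; assumption.
  - apply equiv_atlas_of_inS; [exact HA|].
    intros D chi [[-> ->]|[-> ->]]; assumption.
Qed.

(** * Double cosets and diffeomorphisms *)

Lemma inverses_sym h h' : inverses h h' -> inverses h' h.
Proof. intros H x. split; apply H. Qed.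

Lemma inverses_unique h g g' : inverses h g -> inverses h g' -> g = g'.
Proof.
  intros H H'. apply functional_extensionality. intros x.
  rewrite <- (proj2 (H' x)) at 1. apply H.
Qed.

Lemma Ck_on_all k F : Ck_on k (fun _ => True) F <-> forall x, Ckat k F x.
Proof.
  rewrite Ck_on_Ckat by apply open_true. split; auto.
Qed.

Lemma Dk_id k : Dk k (fun x => x).
Proof.
  exists (fun x => x). split; [intros x; auto|]. split; [reflexivity|].
  split; apply Ck_on_all; intros x; apply Ckat_id.
Qed.

Lemma Dk_inverse k a a' : inverses a a' -> a 0 = 0 ->
  Ck_on k (fun _ => True) a -> Ck_on k (fun _ => True) a' -> Dk k a'.
Proof.
  intros HI H0 C C'. exists a. split; [apply inverses_sym, HI|].
  split; [|split; assumption]. rewrite <- H0 at 1. apply HI.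
Qed.

Lemma Dk_comp k a b : Dk k a -> Dk k b -> Dk k (fun x => a (b x)).
Proof.
  intros [a' [Ia [a0 [Ca Ca']]]] [b' [Ib [b0 [Cb Cb']]]].
  rewrite Ck_on_all in Ca, Ca', Cb, Cb'.
  exists (fun x => b' (a' x)). split; [|split; [|split]].
  - intros x. split.
    + rewrite (proj1 (Ia (b x))). apply Ib.
    + rewrite (proj2 (Ib (a' x))). apply Ia.
  - rewrite b0. exact a0.
  - apply Ck_on_all. intros x. apply Ckat_comp; auto.
  - apply Ck_on_all. intros x. apply Ckat_comp; auto.
Qed.

Lemma dcoset_refl k h : dcoset k h h.
Proof.
  exists (fun x => x), (fun x => x). split; [apply Dk_id|]. split; [apply Dk_id|reflexivity].
Qed.

Lemma dcoset_sym k h g : dcoset k h g -> dcoset k g h.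
Proof.
  intros [a [b [[a' [Ia [a0 [Ca Ca']]]] [[b' [Ib [b0 [Cb Cb']]]] E]]]].
  exists a', b'. split; [apply (Dk_inverse k a); assumption|].
  split; [apply (Dk_inverse k b); assumption|].
  intros x. rewrite E, (proj1 (Ia _)), (proj2 (Ib x)). reflexivity.
Qed.

Lemma dcoset_trans k h g f : dcoset k h g -> dcoset k g f -> dcoset k h f.
Proof.
  intros [a [b [Ha [Hb E]]]] [c [d [Hc [Hd E']]]].
  exists (fun x => c (a x)), (fun x => b (d x)).
  split; [apply Dk_comp; assumption|]. split; [apply Dk_comp; assumption|].
  intros x. rewrite E', E. reflexivity.
Qed.

Lemma dcoset_inverse k h g h' g' :
  inverses h h' -> inverses g g' -> dcoset k h g -> dcoset k h' g'.
Proof.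
  intros Ih Ig [a [b [[a' [Ia [a0 [Ca Ca']]]] [[b' [Ib [b0 [Cb Cb']]]] E]]]].
  exists b', a'. split; [apply (Dk_inverse k b); assumption|].
  split; [apply (Dk_inverse k a); assumption|].
  intros x. assert (H : g (b' (h' (a' x))) = x).
  { rewrite E, (proj2 (Ib _)), (proj2 (Ih _)). apply Ia. }
  rewrite <- H at 1. apply Ig.
Qed.

Lemma dcoset_eq k h g :
  dcoset k h g <-> (forall f, dcoset k h f <-> dcoset k g f).
Proof.
  split.
  - intros H f. split; intros H'; [|apply (dcoset_trans k h g); assumption].
    apply (dcoset_trans k g h); [apply dcoset_sym, H|exact H'].
  - intros H. apply H, dcoset_refl.
Qed.

Lemma pmcoset_inverses k h h' g : inverses h h' ->
  (pmcoset k h g <-> dcoset k h g \/ dcoset k h' g).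
Proof.
  intros Hh. split.
  - intros [H|[h'' [Hh'' H]]]; [left; exact H|right].
    rewrite (inverses_unique h h' h''); assumption.
  - intros [H|H]; [left; exact H|right]. exists h'. auto.
Qed.

(** Inversion carries the double coset of h to that of h', so as soon as one of the two meets the
    pair of g, the two pairs coincide. *)
Lemma pmcoset_eq k h h' g g' : inverses h h' -> inverses g g' ->
  (dcoset k h g \/ dcoset k h' g <-> (forall f, pmcoset k h f <-> pmcoset k g f)).
Proof.
  intros Ih Ig. split.
  - intros H f. rewrite (pmcoset_inverses k h h' f Ih), (pmcoset_inverses k g g' f Ig).
    destruct H as [H|H].
    + pose proof (dcoset_inverse k h g h' g' Ih Ig H) as H'.
      rewrite (proj1 (dcoset_eq k h g) H f), (proj1 (dcoset_eq k h' g') H' f). tauto.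
    + pose proof (dcoset_inverse k h' g h g' (inverses_sym _ _ Ih) Ig H) as H'.
      rewrite (proj1 (dcoset_eq k h' g) H f), (proj1 (dcoset_eq k h g') H' f). tauto.
  - intros H. rewrite <- (pmcoset_inverses k h h' g Ih). apply H. left. apply dcoset_refl.
Qed.

(* A minimal atlas together with its 0-extension, read from either origin: [b] tells
   which origin the first chart is centred at. *)
Record marked (k : reg) (A : atlasT) (b : bool) (chi1 chi2 : L -> R) (gamma : R -> R) : Prop := {
  mk_in1 : inS k A (dom b) chi1;
  mk_in2 : inS k A (dom (negb b)) chi2;
  mk_sur1 : forall y, exists p, dom b p /\ chi1 p = y;
  mk_sur2 : forall y, exists p, dom (negb b) p /\ chi2 p = y;
  mk_org1 : chi1 (org b) = 0;
  mk_org2 : chi2 (org (negb b)) = 0;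
  mk_zero : gamma 0 = 0;
  mk_trans : forall p, dom b p -> dom (negb b) p -> gamma (chi1 p) = chi2 p }.

Lemma marked_flip k A b chi1 chi2 gamma gamma' : inverses gamma gamma' ->
  marked k A b chi1 chi2 gamma -> marked k A (negb b) chi2 chi1 gamma'.
Proof.
  intros HI [I1 I2 S1 S2 O1 O2 Z T].
  split; rewrite ?Bool.negb_involutive; try assumption.
  - rewrite <- Z at 1. apply HI.
  - intros p H2 H1. rewrite <- (T p H1 H2). apply HI.
Qed.

Lemma marked_of_minimal k A phi psi gamma : atlas k A -> minimal_atlas k phi psi ->
  equiv_atlas k A (Mat phi psi) -> zext phi psi gamma -> marked k A true phi psi gamma.
Proof.
  intros HA [HM [S1 [S2 [O1 O2]]]] [EC [EK _]] [Z T].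
  assert (HI : forall D chi, Mat phi psi D chi -> inS k A D chi).
  { intros D chi H. split; [apply EC; right; exact H|].
    intros D' chi' H'. apply EK; [right|left]; assumption. }
  split; try assumption.
  - apply HI. left. auto.
  - apply HI. right. auto.
  - intros p H1 H2. destruct (dom_both true p H1 H2) as [x [Hx ->]]. apply T, Hx.
Qed.

(** * Regularity of the 0-extension *)

Lemma chart_org k A b chi1 chi2 gamma p : marked k A b chi1 chi2 gamma ->
  dom b p -> (chi1 p = 0 <-> p = org b).
Proof.
  intros M Hp. split.
  - intros E. apply (chart_injective (dom b) chi1); [apply M|exact Hp|apply org_dom|].
    rewrite E. symmetry. apply M.
  - intros ->. apply M.
Qed.

(** Extends [mk_trans] across x = 0, where the two sides evaluate charts at different origins and
    agree because both charts are centred. *)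
Lemma marked_emb k A b chi1 chi2 gamma x : marked k A b chi1 chi2 gamma ->
  gamma (chi1 (emb b x)) = chi2 (emb (negb b) x).
Proof.
  intros M. destruct (Req_dec x 0) as [->|Hx].
  - rewrite !emb_0, (mk_org1 _ _ _ _ _ _ M), (mk_org2 _ _ _ _ _ _ M). apply M.
  - rewrite !emb_neq0 by exact Hx. apply M; apply pt_dom, Hx.
Qed.

Lemma marked_emb_onto k A b chi1 chi2 gamma y : marked k A b chi1 chi2 gamma ->
  exists x, chi1 (emb b x) = y.
Proof.
  intros M. destruct (mk_sur1 _ _ _ _ _ _ M y) as [p [Hp E]].
  exists (proj p). rewrite emb_proj; assumption.
Qed.

Lemma marked_Ck k A b chi1 chi2 gamma : atlas k A -> marked k A b chi1 chi2 gamma ->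
  (forall y, continuous gamma y) /\ Ck_on k (fun x => x <> 0) gamma.
Proof.
  intros HA M. pose proof (mk_in1 _ _ _ _ _ _ M) as I1. pose proof (mk_in2 _ _ _ _ _ _ M) as I2.
  split.
  - intros y O HO. destruct (marked_emb_onto k A b chi1 chi2 gamma y M) as [x <-].
    change (locally (chi1 (emb b x)) (fun z => O (gamma z))).
    rewrite (marked_emb k A b chi1 chi2 gamma x M) in HO.
    assert (HV : locally x (fun z => O (chi2 (emb (negb b) z)))).
    { apply (chart_continuous (dom (negb b)) chi2 (negb b) x); [apply I2|apply dom_emb|exact HO]. }
    pose proof (chart_open_map (dom b) chi1 b x _ (proj1 I1) (dom_emb b x) HV) as HI.
    revert HI. apply filter_imp. intros t [z [Hz <-]].
    rewrite (marked_emb k A b chi1 chi2 gamma z M). exact Hz.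
  - apply Ck_on_Ckat; [apply open_neq|]. intros y Hy.
    destruct (mk_sur1 _ _ _ _ _ _ M y) as [p [Hp <-]].
    assert (Hp' : dom (negb b) p).
    { apply dom_negb. intros E. apply Hy, (chart_org k A b chi1 chi2 gamma p M Hp), E. }
    destruct (inS_LCk k A _ _ _ _ p HA I1 I2 Hp Hp') as [F [HF EF]].
    apply (Ckat_ext k F); [|exact HF].
    destruct EF as [S [HS [Sp EF]]].
    apply (filter_imp (imageR (fun q => dom b q /\ (dom (negb b) q /\ S q)) chi1)).
    + intros t [q [[Q1 [Q2 Q3]] <-]]. rewrite (EF q Q3). symmetry.
      apply (mk_trans _ _ _ _ _ _ M); assumption.
    + apply (chart_image_open (dom b) chi1 (fun q => dom (negb b) q /\ S q)); [apply I1| |].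
      * apply openL_and; [apply openL_dom|exact HS].
      * exists p. auto.
Qed.

Lemma marked_inverse k A b chi1 chi2 gamma : marked k A b chi1 chi2 gamma ->
  exists gamma', inverses gamma gamma'.
Proof.
  intros M.
  assert (Sur : forall y, exists z, gamma z = y).
  { intros y. destruct (mk_sur2 _ _ _ _ _ _ M y) as [p [Hp <-]].
    exists (chi1 (emb b (proj p))). rewrite (marked_emb k A b chi1 chi2 gamma _ M).
    rewrite emb_proj; [reflexivity|exact Hp]. }
  assert (Inj : forall y z, gamma y = gamma z -> y = z).
  { intros y z. destruct (marked_emb_onto k A b chi1 chi2 gamma y M) as [u <-].
    destruct (marked_emb_onto k A b chi1 chi2 gamma z M) as [v <-].
    rewrite !(marked_emb k A b chi1 chi2 gamma _ M). intros E.
    apply (chart_injective (dom (negb b)) chi2) in E; [|apply M|apply dom_emb|apply dom_emb].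
    apply (f_equal proj) in E. rewrite !proj_emb in E. rewrite E. reflexivity. }
  exists (fun y => proj1_sig (constructive_indefinite_description _ (Sur y))).
  assert (H : forall y, gamma (proj1_sig (constructive_indefinite_description _ (Sur y))) = y).
  { intros y. exact (proj2_sig (constructive_indefinite_description _ (Sur y))). }
  intros x. split; [apply Inj, H|apply H].
Qed.

Lemma marked_Hk k A b chi1 chi2 gamma : atlas k A -> marked k A b chi1 chi2 gamma -> Hk k gamma.
Proof.
  intros HA M. destruct (marked_inverse k A b chi1 chi2 gamma M) as [gamma' HI].
  destruct (marked_Ck _ _ _ _ _ _ HA M) as [C1 C2].
  (* The inverse is itself the 0-extension of the flipped marking, which gives its regularity. *)
  destruct (marked_Ck _ _ _ _ _ _ HA (marked_flip _ _ _ _ _ _ _ HI M)) as [C1' C2'].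
  exists gamma'. split; [exact HI|]. split; [exact C1|]. split; [exact C1'|].
  split; [apply M|]. split; assumption.
Qed.

Lemma zext_exists k phi psi : minimal_atlas k phi psi -> exists gamma, zext phi psi gamma.
Proof.
  intros [[HC _] [S1 [S2 [O1 O2]]]].
  assert (Inj : forall x y, phi (pt x) = phi (pt y) -> x = y).
  { intros x y E. apply (chart_injective Uset phi) in E; [congruence| | |]; try discriminate.
    apply HC. left. auto. }
  assert (Sur : forall y, exists x, phi (pt x) = y).
  { intros y. destruct (S1 y) as [[x|] [Hp E]]; [exists x; exact E|]. contradiction Hp; reflexivity. }
  set (u := fun y => proj1_sig (constructive_indefinite_description _ (Sur y))).
  assert (Hu : forall y, phi (pt (u y)) = y).
  { intros y. exact (proj2_sig (constructive_indefinite_description _ (Sur y))). }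
  (* [sw] equals [pt] off 0 and sends 0 to [origin'], so one formula also produces the value at
     0. *)
  exists (fun y => psi (sw (u y))). split.
  - replace (u 0) with 0; [rewrite sw_0; exact O2|]. apply Inj. rewrite Hu. exact O1.
  - intros x Hx. replace (u (phi (pt x))) with x; [rewrite sw_neq0; auto|].
    apply Inj. rewrite Hu. reflexivity.
Qed.

(** * Diffeomorphisms read in the charts of minimal atlases *)

Lemma CkL_global k A A' f D chi D' chi' : CkL k A A' f -> inS k A D chi -> inS k A' D' chi' ->
  (forall p, D p -> D' (f p)) -> (forall y, exists p, D p /\ chi p = y) ->
  exists F, Ck_on k (fun _ => True) F /\ forall p, D p -> F (chi p) = chi' (f p).
Proof.
  intros Hf H H' HD Sur. destruct (Hf D chi D' chi' H H') as [F [HF E]].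
  exists F. split; [|auto]. intros n Hn y _. apply HF; [exact Hn|].
  destruct (Sur y) as [p [Dp <-]]. exists p. auto.
Qed.

Lemma diffeo_dcoset k A A' b b' chi1 chi2 chi1' chi2' gamma gamma' f :
  marked k A b chi1 chi2 gamma -> marked k A' b' chi1' chi2' gamma' ->
  diffeo k A A' f -> f (org b) = org b' -> f (org (negb b)) = org (negb b') ->
  dcoset k gamma gamma'.
Proof.
  intros M M' [g [Hfg [_ [_ [Cf Cg]]]]] f1 f2.
  assert (g1 : g (org b') = org b) by (rewrite <- f1; apply Hfg).
  assert (g2 : g (org (negb b')) = org (negb b)) by (rewrite <- f2; apply Hfg).
  assert (Df : forall p, (dom b p -> dom b' (f p)) /\ (dom (negb b) p -> dom (negb b') (f p))).
  { intros p. rewrite !dom_negb. split; intros Hp E; apply Hp.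
    - rewrite <- g2, <- E. symmetry. apply Hfg.
    - rewrite <- g1, <- E. symmetry. apply Hfg. }
  assert (Dg : forall p, (dom b' p -> dom b (g p)) /\ (dom (negb b') p -> dom (negb b) (g p))).
  { intros p. rewrite !dom_negb. split; intros Hp E; apply Hp.
    - rewrite <- f2, <- E. symmetry. apply Hfg.
    - rewrite <- f1, <- E. symmetry. apply Hfg. }
  destruct (CkL_global k A A' f (dom b) chi1 (dom b') chi1' Cf (mk_in1 _ _ _ _ _ _ M)
    (mk_in1 _ _ _ _ _ _ M') (fun p => proj1 (Df p)) (mk_sur1 _ _ _ _ _ _ M)) as [B [CB EB]].
  destruct (CkL_global k A' A g (dom b') chi1' (dom b) chi1 Cg (mk_in1 _ _ _ _ _ _ M')
    (mk_in1 _ _ _ _ _ _ M) (fun p => proj1 (Dg p)) (mk_sur1 _ _ _ _ _ _ M')) as [B' [CB' EB']].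
  destruct (CkL_global k A A' f _ chi2 _ chi2' Cf (mk_in2 _ _ _ _ _ _ M)
    (mk_in2 _ _ _ _ _ _ M') (fun p => proj2 (Df p)) (mk_sur2 _ _ _ _ _ _ M)) as [a [Ca Ea]].
  destruct (CkL_global k A' A g _ chi2' _ chi2 Cg (mk_in2 _ _ _ _ _ _ M')
    (mk_in2 _ _ _ _ _ _ M) (fun p => proj2 (Dg p)) (mk_sur2 _ _ _ _ _ _ M')) as [a' [Ca' Ea']].
  assert (a0 : a 0 = 0).
  { rewrite <- (mk_org2 _ _ _ _ _ _ M), Ea, f2 by apply org_dom. rewrite (mk_org2 _ _ _ _ _ _ M).
    apply M'. }
  exists a, B'. split; [|split].
  - exists a'. split; [|auto]. intros y. split.
    + destruct (mk_sur2 _ _ _ _ _ _ M y) as [p [Hp <-]].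
      rewrite (Ea p Hp), Ea' by apply Df, Hp. rewrite (proj1 (Hfg p)). reflexivity.
    + destruct (mk_sur2 _ _ _ _ _ _ M' y) as [p [Hp <-]].
      rewrite (Ea' p Hp), Ea by apply Dg, Hp. rewrite (proj2 (Hfg p)). reflexivity.
  - exists B. split; [|split; [|auto]].
    + intros y. split.
      * destruct (mk_sur1 _ _ _ _ _ _ M' y) as [p [Hp <-]].
        rewrite (EB' p Hp), EB by apply Dg, Hp. rewrite (proj2 (Hfg p)). reflexivity.
      * destruct (mk_sur1 _ _ _ _ _ _ M y) as [p [Hp <-]].
        rewrite (EB p Hp), EB' by apply Df, Hp. rewrite (proj1 (Hfg p)). reflexivity.
    + rewrite <- (mk_org1 _ _ _ _ _ _ M'), EB', g1 by apply org_dom.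
      rewrite (mk_org1 _ _ _ _ _ _ M'). apply M.
  - intros y. destruct (mk_sur1 _ _ _ _ _ _ M' y) as [p [Hp <-]].
    (* gamma' = a ∘ gamma ∘ B' follows from the transition identities on the overlap; at the first
       origin, which lies outside it, both sides are 0. *)
    rewrite (EB' p Hp). destruct (classic (p = org b')) as [->|Hn].
    + rewrite g1, (mk_org1 _ _ _ _ _ _ M), (mk_org1 _ _ _ _ _ _ M').
      rewrite (mk_zero _ _ _ _ _ _ M), (mk_zero _ _ _ _ _ _ M'). symmetry. exact a0.
    + apply dom_negb in Hn.
      rewrite (mk_trans _ _ _ _ _ _ M') by assumption.
      rewrite (mk_trans _ _ _ _ _ _ M) by (apply Dg; assumption).
      rewrite Ea by apply Dg, Hn. rewrite (proj2 (Hfg p)). reflexivity.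
Qed.

(** One C^k expression in one pair of charts around each point suffices: continuity follows from
    that of F, and other charts are reached by transitivity. *)
Lemma CkL_of_charts k A A' f : atlas k A -> atlas k A' ->
  (forall p, exists D phi D' phi' F, inS k A D phi /\ D p /\ inS k A' D' phi' /\
    (forall q, D q -> D' (f q) /\ phi' (f q) = F (phi q)) /\ (forall t, Ckat k F t)) ->
  contL f /\ CkL k A A' f.
Proof.
  intros HA HA' H.
  assert (Cf : contL f).
  { intros S HS. apply openL_of_locL. intros p Sp.
    destruct (H p) as [D [phi [D' [phi' [F [[HC _] [Dp [[HC' _] [HF CF]]]]]]]]].
    exists (fun q => D q /\ imageR (fun r => D' r /\ S r) phi' (F (phi q))).
    split; [|split].
    - destruct HC as [_ [_ [_ [HC _]]]].
      apply (HC (fun t => imageR (fun r => D' r /\ S r) phi' (F t))).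
      apply (open_comp F (imageR (fun r => D' r /\ S r) phi')).
      + intros t _. apply (Ckat_continuous k), CF.
      + apply chart_image_open; assumption.
    - split; [exact Dp|]. exists (f p). destruct (HF p Dp). auto.
    - intros q [Dq [r [[Dr Sr] E]]]. destruct (HF q Dq) as [Dq' Eq].
      rewrite <- Eq in E. apply (chart_injective D' phi' HC') in E; [|assumption|assumption].
      rewrite <- E. exact Sr. }
  split; [exact Cf|]. intros D1 phi1 D2 phi2 H1 H2.
  apply (LCk_glue k D1 phi1 (fun p => D2 (f p)) (fun p => phi2 (f p))); [apply H1| |].
  { apply Cf, H2. }
  intros p P1 P2. destruct (H p) as [D [phi [D' [phi' [F [HI [Dp [HI' [HF CF]]]]]]]]].
  apply (LCk_trans k p phi1 phi); [apply (inS_LCk k A D1 phi1 D phi); assumption|].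
  apply (LCk_trans k p phi (fun q => phi' (f q))).
  - exists F. split; [apply CF|]. exists D. split; [apply HI|]. split; [exact Dp|].
    intros q Dq. symmetry. apply HF, Dq.
  - apply (LCk_pull k f p phi' phi2 Cf).
    apply (inS_LCk k A' D' phi' D2 phi2); try assumption. apply HF, Dp.
Qed.

(** f is defined through the first charts, and by hand at the one point they miss. The identity
    gamma' = a ∘ gamma ∘ c is exactly what makes it act by a in the second charts on the overlap. *)
Lemma dcoset_map k A A' b b' chi1 chi2 chi1' chi2' gamma gamma' (a c c' : R -> R) :
  marked k A b chi1 chi2 gamma -> marked k A' b' chi1' chi2' gamma' ->
  inverses c c' -> c 0 = 0 -> a 0 = 0 -> (forall y, gamma' y = a (gamma (c y))) ->
  exists f, (forall p, dom b p -> dom b' (f p) /\ chi1' (f p) = c' (chi1 p)) /\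
    (forall p, dom (negb b) p -> dom (negb b') (f p) /\ chi2' (f p) = a (chi2 p)).
Proof.
  intros M M' Ic c0 a0 E.
  set (pick := fun y => proj1_sig (constructive_indefinite_description _ (mk_sur1 _ _ _ _ _ _ M' y))).
  assert (Hpick : forall y, dom b' (pick y) /\ chi1' (pick y) = y).
  { intros y. exact (proj2_sig (constructive_indefinite_description _ (mk_sur1 _ _ _ _ _ _ M' y))). }
  set (f := fun p => if excluded_middle_informative (p = org (negb b))
    then org (negb b') else pick (c' (chi1 p))).
  assert (F1 : forall p, dom b p -> dom b' (f p) /\ chi1' (f p) = c' (chi1 p)).
  { intros p Hp. unfold f. destruct (excluded_middle_informative (p = org (negb b))) as [Ep|_];
      [contradiction|]. apply Hpick. }
  exists f. split; [exact F1|]. intros p Hp.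
  destruct (classic (p = org (negb b))) as [Ep|Ep].
  - assert (Ef : f p = org (negb b')).
    { unfold f. destruct (excluded_middle_informative (p = org (negb b))); [reflexivity|contradiction]. }
    rewrite Ef, Ep. split; [apply org_dom|].
    rewrite (mk_org2 _ _ _ _ _ _ M), (mk_org2 _ _ _ _ _ _ M'). symmetry. exact a0.
  - destruct (F1 p Ep) as [D1 C1].
    assert (D2 : dom (negb b') (f p)).
    (* If f p were the first origin, then chi1 p = c 0 = 0, so p would be the first origin
       itself. *)
    { apply dom_negb. intros Ef. apply (proj1 (dom_negb b p) Hp).
      apply (chart_org k A b chi1 chi2 gamma p M Ep).
      rewrite Ef, (mk_org1 _ _ _ _ _ _ M') in C1.
      rewrite <- (proj2 (Ic (chi1 p))), <- C1. exact c0. }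
    split; [exact D2|].
    rewrite <- (mk_trans _ _ _ _ _ _ M' (f p) D1 D2), C1, E, (proj2 (Ic _)).
    rewrite (mk_trans _ _ _ _ _ _ M p Ep Hp). reflexivity.
Qed.

Lemma bool_dom_cover b p : dom b p \/ dom (negb b) p.
Proof. destruct b; simpl; destruct (dom_cover p); tauto. Qed.

Lemma dcoset_diffeo k A A' b b' chi1 chi2 chi1' chi2' gamma gamma' :
  atlas k A -> atlas k A' ->
  marked k A b chi1 chi2 gamma -> marked k A' b' chi1' chi2' gamma' ->
  dcoset k gamma gamma' ->
  exists f, diffeo k A A' f /\ f (org b) = org b' /\ f (org (negb b)) = org (negb b').
Proof.
  intros HA HA' M M' [a [c [[a' [Ia [a0 [Ca Ca']]]] [[c' [Ic [c0 [Cc Cc']]]] E]]]].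
  rewrite Ck_on_all in Ca, Ca', Cc, Cc'.
  assert (c0' : c' 0 = 0) by (rewrite <- c0 at 1; apply Ic).
  assert (a0' : a' 0 = 0) by (rewrite <- a0 at 1; apply Ia).
  assert (E' : forall y, gamma y = a' (gamma' (c' y))).
  { intros y. rewrite E, (proj1 (Ia _)), (proj2 (Ic y)). reflexivity. }
  destruct (dcoset_map k A A' b b' chi1 chi2 chi1' chi2' gamma gamma' a c c' M M' Ic c0 a0 E)
    as [f [F1 F2]].
  (* The inverse map is the same construction for gamma = a' ∘ gamma' ∘ c', acting by c and a'. *)
  destruct (dcoset_map k A' A b' b chi1' chi2' chi1 chi2 gamma' gamma a' c' c M' M
    (inverses_sym _ _ Ic) c0' a0' E') as [g [G1 G2]].
  destruct (CkL_of_charts k A A' f HA HA') as [Cf Kf].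
  { intros p. destruct (bool_dom_cover b p) as [Hp|Hp].
    - exists (dom b), chi1, (dom b'), chi1', c'.
      split; [apply M|]. split; [exact Hp|].
      split; [apply M'|]. split; assumption.
    - exists (dom (negb b)), chi2, (dom (negb b')), chi2', a.
      split; [apply M|]. split; [exact Hp|].
      split; [apply M'|]. split; assumption. }
  destruct (CkL_of_charts k A' A g HA' HA) as [Cg Kg].
  { intros p. destruct (bool_dom_cover b' p) as [Hp|Hp].
    - exists (dom b'), chi1', (dom b), chi1, c.
      split; [apply M'|]. split; [exact Hp|].
      split; [apply M|]. split; assumption.
    - exists (dom (negb b')), chi2', (dom (negb b)), chi2, a'.
      split; [apply M'|]. split; [exact Hp|].
      split; [apply M|]. split; assumption. }
  exists f. split; [exists g; split; [|auto]|split].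
  - intros p. split.
    + destruct (bool_dom_cover b p) as [Hp|Hp].
      * destruct (F1 p Hp) as [D1 C1]. destruct (G1 _ D1) as [D2 C2].
        apply (chart_injective (dom b) chi1); try assumption; [apply M|].
        rewrite C2, C1. apply Ic.
      * destruct (F2 p Hp) as [D1 C1]. destruct (G2 _ D1) as [D2 C2].
        apply (chart_injective (dom (negb b)) chi2); try assumption; [apply M|].
        rewrite C2, C1. apply Ia.
    + destruct (bool_dom_cover b' p) as [Hp|Hp].
      * destruct (G1 p Hp) as [D1 C1]. destruct (F1 _ D1) as [D2 C2].
        apply (chart_injective (dom b') chi1'); try assumption; [apply M'|].
        rewrite C2, C1. apply Ic.
      * destruct (G2 p Hp) as [D1 C1]. destruct (F2 _ D1) as [D2 C2].
        apply (chart_injective (dom (negb b')) chi2'); try assumption; [apply M'|].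
        rewrite C2, C1. apply Ia.
  - destruct (F1 (org b) (org_dom b)) as [D1 C1].
    apply (chart_org k A' b' chi1' chi2' gamma' _ M' D1).
    rewrite C1, (mk_org1 _ _ _ _ _ _ M). exact c0'.
  - destruct (F2 (org (negb b)) (org_dom _)) as [D1 C1].
    apply (chart_injective (dom (negb b')) chi2'); [apply M'|exact D1|apply org_dom|].
    rewrite C1, (mk_org2 _ _ _ _ _ _ M), (mk_org2 _ _ _ _ _ _ M'). exact a0.
Qed.

(* The two origins cannot be separated, hence neither can their images. *)
Lemma homeo_origins (f g : L -> L) : (forall p, g (f p) = p /\ f (g p) = p) -> contL f ->
  exists b, f (org true) = org b /\ f (org false) = org (negb b).
Proof.
  intros Hfg Cf.
  assert (N : f (pt 0) <> f origin').
  { intros E. apply (f_equal g) in E. rewrite (proj1 (Hfg (pt 0))), (proj1 (Hfg origin')) in E.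
    discriminate. }
  assert (C : forall b, continuous (fun x => proj (f (emb b x))) 0).
  { intros b V HV. destruct (locally_open_ex _ _ HV) as [O [HO [O0 HOV]]].
    change (locally 0 (fun x => V (proj (f (emb b x))))).
    apply (filter_imp (fun x => O (proj (f (emb b x))))); [intros x; apply HOV|].
    apply (proj1 (openL_emb _) (Cf _ (openL_proj O HO)) b 0 O0). }
  assert (E : proj (f (emb true 0)) = proj (f (emb false 0))).
  { apply NNPP. intros Hne.
    assert (CD : continuous (fun x => proj (f (emb true x)) - proj (f (emb false x))) 0).
    { apply (continuous_minus (fun x => proj (f (emb true x))) (fun x => proj (f (emb false x))));
        apply C. }
    assert (HD : locally 0 (fun x => proj (f (emb true x)) - proj (f (emb false x)) <> 0)).
    { apply (CD (fun u => u <> 0)). apply (open_neq 0). lra. }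
    apply locally_abs in HD. destruct HD as [d [Hd HD]].
    apply (HD (d / 2)).
    - rewrite Rminus_0_r, Rabs_pos_eq; lra.
    - rewrite !emb_neq0 by lra. ring. }
  (* Distinct points of L with equal projections can only be the two origins. *)
  rewrite !emb_0 in E. simpl in E.
  destruct (f (pt 0)) as [x|] eqn:Ex, (f origin') as [y|] eqn:Ey; simpl in E.
  - contradiction N. congruence.
  - exists true. simpl. rewrite Ex, Ey, E. auto.
  - exists false. simpl. rewrite Ex, Ey, <- E. auto.
  - contradiction N. reflexivity.
Qed.

(** The identity on U and h on V have transition map h on the overlap, where h and its inverse are
    C^k. *)
Lemma Hk_minimal_atlas k h : Hk k h -> exists phi psi, minimal_atlas k phi psi /\ zext phi psi h.
Proof.
  intros [h' [HI [Ch [Ch' [h0 [Kh Kh']]]]]].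
  assert (Iid : inverses (fun x : R => x) (fun x => x)) by (intros x; auto).
  pose proof (homeo_chart true _ _ Iid (fun x => continuous_id x) (fun x => continuous_id x)) as C1.
  pose proof (homeo_chart false h h' HI Ch Ch') as C2.
  simpl in C1.
  assert (HR : forall D chi, Mat proj (fun p => h (proj p)) D chi ->
    is_chart D chi).
  { intros D chi [[-> ->]|[-> ->]]; assumption. }
  assert (h'0 : h' 0 = 0) by (rewrite <- h0 at 1; apply HI).
  assert (LR : forall p (chi : L -> R), LCk k p chi chi).
  { intros p chi. exists (fun t => t). split; [apply Ckat_id|].
    exists (fun _ => True). split; [apply openL_emb; intros b; apply open_true|]. auto. }
  assert (L12 : forall p, dom true p -> dom false p ->
    LCk k p proj (fun q => h (proj q)) /\ LCk k p (fun q => h (proj q)) proj).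
  { intros p P1 P2. destruct (dom_both true p P1 P2) as [x [Hx ->]].
    split.
    - exists h. split; [apply (proj1 (Ck_on_Ckat k _ h (open_neq 0)) Kh), Hx|].
      exists (fun _ => True). split; [apply openL_emb; intros b; apply open_true|]. auto.
    - exists h'. split.
      + apply (proj1 (Ck_on_Ckat k _ h' (open_neq 0)) Kh'). simpl.
        intros E. apply Hx. rewrite <- (proj1 (HI x)), E. exact h'0.
      + exists (fun _ => True). split; [apply openL_emb; intros b; apply open_true|].
        split; [exact I|]. intros q _. apply HI. }
  exists proj, (fun p => h (proj p)). split.
  - split; [split; [exact HR|split]|split; [|split; [|split]]].
    + intros D chi D' chi' H H'. apply compat_of_LCk; [apply HR, H|apply HR, H'|].
      intros p Dp Dp'.
      destruct H as [[-> ->]|[-> ->]], H' as [[-> ->]|[-> ->]]; auto; destruct (L12 p); auto.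
    + intros p. destruct (dom_cover p) as [H|H].
      * exists (dom true), proj. split; [left; auto|exact H].
      * exists (dom false), (fun p => h (proj p)). split; [right; auto|exact H].
    + intros y. exists (pt y). split; [discriminate|reflexivity].
    + intros y. exists (emb false (h' y)). split; [apply (dom_emb false)|].
      rewrite proj_emb. apply HI.
    + reflexivity.
    + exact h0.
  - split; [exact h0|reflexivity].
Qed.

Lemma equiv_atlas_refl k A : atlas k A -> equiv_atlas k A A.
Proof.
  intros HA. apply equiv_atlas_of_inS; [exact HA|]. intros D phi H. apply inS_member; assumption.
Qed.

Theorem theorem5p13 (k : reg) (hk : k <> Fin 0) :
  (* every C^k-structure contains a minimal atlas *)
  (forall A, atlas k A ->
     exists phi psi, minimal_atlas k phi psi /\ equiv_atlas k A (Mat phi psi)) /\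
  (* the 0-extension exists and lies in H^k(R,0) *)
  (forall phi psi, minimal_atlas k phi psi ->
     (exists gamma, zext phi psi gamma) /\
     (forall gamma, zext phi psi gamma -> Hk k gamma)) /\
  (* (1): well-defined and injective on structures modulo diffeomorphism *)
  (forall A A' phi psi phi' psi' gamma gamma',
     atlas k A -> atlas k A' ->
     minimal_atlas k phi psi -> minimal_atlas k phi' psi' ->
     equiv_atlas k A (Mat phi psi) -> equiv_atlas k A' (Mat phi' psi') ->
     zext phi psi gamma -> zext phi' psi' gamma' ->
     ((exists f, diffeo k A A' f) <->
      (forall g, pmcoset k gamma g <-> pmcoset k gamma' g))) /\
  (* (1): surjective onto the (D^k,+-)-double cosets in H^k *)
  (forall h, Hk k h ->
     exists A phi psi gamma, atlas k A /\ minimal_atlas k phi psi /\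
       equiv_atlas k A (Mat phi psi) /\ zext phi psi gamma /\
       (forall g, pmcoset k gamma g <-> pmcoset k h g)) /\
  (* (2): well-defined and injective modulo origin-fixing diffeomorphisms *)
  (forall A A' phi psi phi' psi' gamma gamma',
     atlas k A -> atlas k A' ->
     minimal_atlas k phi psi -> minimal_atlas k phi' psi' ->
     equiv_atlas k A (Mat phi psi) -> equiv_atlas k A' (Mat phi' psi') ->
     zext phi psi gamma -> zext phi' psi' gamma' ->
     ((exists f, diffeo k A A' f /\ fixes_origins f) <->
      (forall g, dcoset k gamma g <-> dcoset k gamma' g))) /\
  (* (2): surjective onto the D^k-double cosets in H^k *)
  (forall h, Hk k h ->
     exists A phi psi gamma, atlas k A /\ minimal_atlas k phi psi /\
       equiv_atlas k A (Mat phi psi) /\ zext phi psi gamma /\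
       (forall g, dcoset k gamma g <-> dcoset k h g)).
Proof.
  assert (Sur : forall h, Hk k h -> exists A phi psi, atlas k A /\ minimal_atlas k phi psi /\
    equiv_atlas k A (Mat phi psi) /\ zext phi psi h).
  { intros h Hh. destruct (Hk_minimal_atlas k h Hh) as [phi [psi [HM HZ]]].
    exists (Mat phi psi), phi, psi. pose proof (proj1 HM) as HA.
    split; [exact HA|]. split; [exact HM|]. split; [apply equiv_atlas_refl, HA|exact HZ]. }
  split; [intros A HA; apply minimal_atlas_exists; assumption|].
  split; [|split; [|split; [|split]]].
  - intros phi psi HM. split; [apply (zext_exists k), HM|]. intros gamma HZ.
    pose proof (proj1 HM) as HA.
    apply (marked_Hk k (Mat phi psi) true phi psi gamma HA).
    apply marked_of_minimal; try assumption. apply equiv_atlas_refl, HA.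
  - intros A A' phi psi phi' psi' gamma gamma' HA HA' HM HM' HE HE' HZ HZ'.
    pose proof (marked_of_minimal k A phi psi gamma HA HM HE HZ) as M.
    pose proof (marked_of_minimal k A' phi' psi' gamma' HA' HM' HE' HZ') as M'.
    destruct (marked_inverse _ _ _ _ _ _ M) as [delta HI].
    destruct (marked_inverse _ _ _ _ _ _ M') as [delta' HI'].
    (* N serves the exchanging diffeomorphisms: such an f carries the first origin of N to that of
       M'. *)
    pose proof (marked_flip _ _ _ _ _ _ _ HI M) as N.
    rewrite <- (pmcoset_eq k gamma delta gamma' delta' HI HI'). split.
    + intros [f Hf]. pose proof Hf as Hf'. destruct Hf' as [g [Hfg [Cf _]]].
      destruct (homeo_origins f g Hfg Cf) as [[|] [f1 f2]].
      * left. apply (diffeo_dcoset k A A' true true phi psi phi' psi' gamma gamma' f); assumption.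
      * right. apply (diffeo_dcoset k A A' false true psi phi phi' psi' delta gamma' f); assumption.
    + intros [H|H].
      * destruct (dcoset_diffeo k A A' _ _ _ _ _ _ _ _ HA HA' M M' H) as [f [Hf _]].
        exists f. exact Hf.
      * destruct (dcoset_diffeo k A A' _ _ _ _ _ _ _ _ HA HA' N M' H) as [f [Hf _]].
        exists f. exact Hf.
  - intros h Hh. destruct (Sur h Hh) as [A [phi [psi [HA [HM [HE HZ]]]]]].
    exists A, phi, psi, h.
    split; [exact HA|]. split; [exact HM|]. split; [exact HE|]. split; [exact HZ|]. tauto.
  - intros A A' phi psi phi' psi' gamma gamma' HA HA' HM HM' HE HE' HZ HZ'.
    pose proof (marked_of_minimal k A phi psi gamma HA HM HE HZ) as M.
    pose proof (marked_of_minimal k A' phi' psi' gamma' HA' HM' HE' HZ') as M'.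
    rewrite <- dcoset_eq. split.
    + intros [f [Hf [f1 f2]]].
      apply (diffeo_dcoset k A A' true true phi psi phi' psi' gamma gamma' f); assumption.
    + intros H. destruct (dcoset_diffeo k A A' _ _ _ _ _ _ _ _ HA HA' M M' H) as [f [Hf [f1 f2]]].
      exists f. split; [exact Hf|]. split; assumption.
  - intros h Hh. destruct (Sur h Hh) as [A [phi [psi [HA [HM [HE HZ]]]]]].
    exists A, phi, psi, h.
    split; [exact HA|]. split; [exact HM|]. split; [exact HE|]. split; [exact HZ|]. tauto.
Qed.
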